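(* Let $n\geq2$, let $\Bbbk$ be a (finite or infinite) countable field, and let $x_1,\ldots,x_n$ be algebraically independent over $\Bbbk$. Then the set $\mathrm{ZR}(\Bbbk(x_1,\ldots,x_n)/\Bbbk)^{\Bbbk}$ is a totally disconnected perfect metrizable space for the Patch topology. Moreover, if $\Bbbk$ is finite, it is a Cantor set for the Patch and the Zariski topologies.
   Context: For a field extension $\Bbbk\subset\mathbb K$, $\mathrm{ZR}(\mathbb K/\Bbbk)$ is the set of valuations $\nu:\mathbb K\to\Gamma_\nu\cup\{\infty\}$ on $\mathbb K$ (with $\Gamma_\nu$ a totally ordered abelian group) that are trivial on $\Bbbk$ ($\nu(a)=0$ for $a\in\Bbbk\setminus\{0\}$), two valuations being identified when they have the same valuation ring. $\mathrm{ZR}(\mathbb K/\Bbbk)^{\Bbbk}$ is the subset of valuations whose residue field is $\Bbbk$ (the natural map from $\Bbbk$ to the residue field is an isomorphism). For $x\in\mathbb K$ let $\mathcal O(x)=\{\nu\mid\nu(x)\geq0\}$ and $\mathcal U(x)=\{\nu\mid\nu(x)>0\}$. The Zariski topology is generated by the $\mathcal O(x)$, and the Patch topology by all the $\mathcal O(x)$ and $\mathcal U(x)$, $x\in\mathbb K$; subsets carry the induced topologies. A space is perfect if it has no isolated points. A Cantor set is a non-empty, compact, metrizable, totally disconnected, perfect space. *)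

(* Defs.v *)
From HB Require Import structures.
From mathcomp Require Import all_boot all_order all_algebra.
From mathcomp Require Import all_classical all_reals topology.
From mathcomp Require Import -(notations) mpoly.

Set Implicit Arguments.
Unset Strict Implicit.
Unset Printing Implicit Defensive.

Import Order.TTheory GRing.Theory Num.Theory.

Local Open Scope classical_set_scope.
Local Open Scope ring_scope.

(* [option G] stands for $G \cup \{\infty\}$, with [None] for $\infty$. *)
Section WithInfinity.
Context {G : porderZmodType}.
Implicit Types a b : option G.

Definition oadd a b : option G :=
  if a is Some x then if b is Some y then Some (x + y) else None else None.

Definition ole a b : bool :=
  if b is Some y then if a is Some x then x <= y else false else true.

Definition olt a b : bool := (a != b) && ole a b.

Definition omin a b : option G := if ole a b then a else b.

End WithInfinity.

(* [porderZmodType] does not relate the order to the addition and does not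
   make it total, so both are required here. *)
Record valuation (K : fieldType) := Valuation {
  vgroup : porderZmodType;
  vgroup_total : forall x y : vgroup, (x <= y) || (y <= x);
  vgroup_leD : forall z x y : vgroup, x <= y -> z + x <= z + y;
  vfun :> K -> option vgroup;
  vfun_eq_infty : forall x, vfun x = None <-> x = 0;
  vfunM : forall x y, vfun (x * y) = oadd (vfun x) (vfun y);
  vfunD : forall x y, ole (omin (vfun x) (vfun y)) (vfun (x + y))
}.

Section ValuationRing.
Context {K : fieldType}.
Implicit Type v : valuation K.

Definition valuation_ring v : set K := [set x | ole (Some 0) (v x)].

(* The residue field consists of the cosets [x + m] for [x] in the valuation
   ring, where [m] is the maximal ideal [{y | v y > 0}]. *)
Definition residue_class v (x : K) : set K := [set y | olt (Some 0) (v (y - x))].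

Definition residue_field v : set (set K) :=
  residue_class v @` valuation_ring v.

End ValuationRing.

Section ZariskiRiemann.
Context {k K : fieldType} (iota : {rmorphism k -> K}).

Definition trivial_on (v : valuation K) : Prop :=
  forall a : k, a != 0 -> v (iota a) = Some 0.

(* The natural map to the residue field is a ring morphism, hence it is an
   isomorphism exactly when it is bijective. *)
Definition has_residue_field (v : valuation K) : Prop :=
  set_bij [set: k] (residue_field v) (fun a => residue_class v (iota a)).

(* Since two valuations are identified when they have the same valuation ring,
   the class of a valuation is represented by that ring. A quotient of the type
   [valuation K] itself would lie in too large a universe to be topologized. *)
Definition ZR : Type :=
  {A : set K | exists2 v : valuation K, trivial_on v & valuation_ring v = A}.

Definition ZR_classes (P : valuation K -> Prop) : set ZR :=
  [set p | exists v : valuation K,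
     [/\ trivial_on v, valuation_ring v = sval p & P v]].

Definition ZR_O (x : K) : set ZR :=
  ZR_classes (fun v => ole (Some 0) (v x)).

Definition ZR_U (x : K) : set ZR :=
  ZR_classes (fun v => olt (Some 0) (v x)).

Definition ZR_zariski : Type := ZR.
Definition ZR_patch : Type := ZR.

HB.instance Definition _ := gen_eqMixin ZR_zariski.
HB.instance Definition _ := gen_choiceMixin ZR_zariski.
HB.instance Definition _ :=
  @isSubBaseTopological.Build ZR_zariski (set ZR) (range ZR_O) id.

HB.instance Definition _ := gen_eqMixin ZR_patch.
HB.instance Definition _ := gen_choiceMixin ZR_patch.
HB.instance Definition _ :=
  @isSubBaseTopological.Build ZR_patch (set ZR)
    (range ZR_O `|` range ZR_U) id.

(* The subtypes [set_type _] carry the induced topologies. *)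
Definition ZRk_zariski : topologicalType :=
  set_type (ZR_classes has_residue_field : set ZR_zariski).
Definition ZRk_patch : topologicalType :=
  set_type (ZR_classes has_residue_field : set ZR_patch).

End ZariskiRiemann.

Arguments ZR_zariski {k K} iota.
Arguments ZR_patch {k K} iota.
Arguments ZRk_zariski {k K} iota.
Arguments ZRk_patch {k K} iota.

Section RationalFunctions.
Context {k K : fieldType} (iota : {rmorphism k -> K}) {n : nat}.
Variable x : 'I_n -> K.

Definition algebraically_independent : Prop :=
  forall p : mpoly n k, mmap iota x p = 0 -> p = 0.

(* $K = k(x_1, \dots, x_n)$ *)
Definition generates_field : Prop :=
  forall z : K, exists p q : mpoly n k,
    mmap iota x q != 0 /\ z = mmap iota x p / mmap iota x q.

End RationalFunctions.

Section TopologicalNotions.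
Variables (R : realType) (T : topologicalType).

Definition metrizable : Prop :=
  exists d : T -> T -> R,
    [/\ forall x y, d x y = 0 <-> x = y,
        forall x y, d x y = d y x,
        forall x y z, d x z <= d x y + d y z
      & forall (x : T) (A : set T),
          nbhs x A <-> exists2 e : R, 0 < e & [set y | d x y < e] `<=` A].

Definition perfect : Prop := isolated [set: T] = set0.

Definition is_cantor_set : Prop :=
  [/\ [set: T] !=set0, compact [set: T], metrizable,
      totally_disconnected [set: T] & perfect].

End TopologicalNotions.

(* Main.v *)
Require Import Defs.
From HB Require Import structures.
From mathcomp Require Import -(notations) mpoly.
From mathcomp Require Import all_boot all_order all_algebra all_field finmap.
From mathcomp Require Import all_classical all_reals topology.
From mathcomp Require Import ring zify.

Set Implicit Arguments.
Unset Strict Implicit.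
Unset Printing Implicit Defensive.

Import Order.TTheory GRing.Theory Num.Theory.

Local Open Scope classical_set_scope.
Local Open Scope ring_scope.

(** A point of the space is determined by a valuation ring [A] of [K] that
    contains [k] and in which every element is congruent to an element of [k]
    modulo the maximal ideal; such rings are called places below ([place],
    [placeP]).  A patch neighbourhood of [A] prescribes the membership of
    finitely many elements of [K], so the space embeds in the product of [K]
    copies of a two-point space.  As [K] is countable, this gives a metric and
    total disconnectedness at once.  If [k] is finite, being a place is a closed
    condition, since the residue of an element is then chosen among finitely
    many constants ([ultra_place]); this is compactness.  Moreover [x] has
    positive value exactly when [x] and all [1 / (x - a)] with [a] a nonzero
    constant belong to the ring, so both topologies agree ([zariski_nbhs]).

    The substance is that no place is isolated.  Write [K = F(X)] with
    [F = k(x_1, ..., x_{n-1})] and [X = x_n].  Extend the valuation of [A] to an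
    algebraic closure [L] of [K] ([valring_extend]), and write it
    multiplicatively as a total preorder, [x <=| y] meaning that [x / y] is
    integral.  Let [Fbar] be the algebraic closure of [F] in [L].  For [b] and
    [c] in [Fbar] with [c != 0], substitute [b + c Y] for [X] and use the Gauss
    norm on [L[Y]], refined by the first exponent at which it is attained.  This
    is a new valuation of [K], for which [|X - a|] is [|b - a|] if this is at
    least [|c|], and is infinitely close to [|c|], from below, otherwise.  Let
    [Q] over [F] vanish at [b].  Suppose that the roots of all nonzero
    polynomials over [F] of smaller degree than [Q] have distances from [b] that
    are larger than [|X - b|] and [|c|].  Then such polynomials have equivalent
    values at [X] and at [b], while different powers of [Q] are told apart by the
    exponents at which their Gauss norms are attained.  Hence every polynomial is equivalent to a
    single term [r Q^i], and residues are computed on [r]: the residue field is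
    still [k] ([recenter_place]).

    Finitely many elements of [K] involve finitely many linear factors [X - a]
    over [L], so it remains to choose [b] and [c] so that these factors keep
    their sizes, or change them harmlessly.  If all [|X - a|], [a] in [Fbar], are
    values of [Fbar], then [X] has no best approximation, because residues of
    [L] are represented by [Fbar] ([residue_algebraic]); one takes [b] of minimal
    degree closer to [X] than all the given roots, and [|c|] in between
    ([two_places_immediate]).  Otherwise [g = X - a0] has a size that is no value
    of [Fbar], every other [|X - a|] is [|g|] or a value of [Fbar], and each
    given condition compares [|g|] with a value of [Fbar] ([threshold]); one
    replaces [|g|] by a nearby value [|c|] of [Fbar]
    ([two_places_transcendental]).  As [n >= 2], some element of [F] has a
    nontrivial value, so the value group of [Fbar] is dense and there is room for
    two different [|c|]; these give different places ([distinct_places]), one of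
    which is not [A]. *)

(** * Valuations as preorders *)

(** The preorder [|x| <= |y|] of a multiplicative valuation.  Working with it
    avoids a value group: elements of a field stand for their own values. *)
Record norm_rel (R : idomainType) (le : rel R) : Prop := NormRel {
  nle_total : forall x y, le x y || le y x;
  nle_trans : forall y x z, le x y -> le y z -> le x z;
  nle_pmul2r : forall z x y, z != 0 -> le (x * z) (y * z) = le x y;
  nleD : forall x y z, le x z -> le y z -> le (x + y) z;
  nle0 : forall x, le x 0 -> x = 0
}.

Section NormTheory.
Variables (R : idomainType) (le : rel R).
Hypothesis N : norm_rel le.

Local Notation "x <=| y" := (le x y) (at level 70, no associativity).
Local Notation "x <| y" := (~~ le y x) (at level 70, no associativity).

Lemma nle_refl x : x <=| x.
Proof. by have := nle_total N x x; rewrite orbb. Qed.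

Lemma nltW x y : x <| y -> x <=| y.
Proof. by have := nle_total N x y; case: (x <=| y) => //= ->. Qed.

Lemma nlt_le_trans y x z : x <| y -> y <=| z -> x <| z.
Proof. by move=> xy yz; apply: contra xy => zx; apply: (nle_trans N) yz zx. Qed.

Lemma nle_lt_trans y x z : x <=| y -> y <| z -> x <| z.
Proof. by move=> xy; apply: contra => zx; apply: (nle_trans N) zx xy. Qed.

Lemma nlt_trans y x z : x <| y -> y <| z -> x <| z.
Proof. by move=> xy /nltW; apply: nlt_le_trans. Qed.

Lemma nle0x x : 0 <=| x.
Proof.
by case/orP: (nle_total N 0 x) => // /(nle0 N) ->; apply: nle_refl.
Qed.

Lemma nlt0x x : (0 <| x) = (x != 0).
Proof.
apply/idP/idP => [|x0]; first by apply: contraNneq => ->; apply: nle_refl.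
by apply: contra x0 => /(nle0 N) ->.
Qed.

Lemma nlt_neq0 x y : x <| y -> y != 0.
Proof. by move=> xy; rewrite -nlt0x; apply: nle_lt_trans xy; apply: nle0x. Qed.

Lemma nle_neq0 x y : x <=| y -> x != 0 -> y != 0.
Proof. by rewrite -!nlt0x => xy x0; apply: nlt_le_trans xy. Qed.

Lemma nle_mul2r z x y : x <=| y -> x * z <=| y * z.
Proof.
have [->|z0] := eqVneq z 0; first by rewrite !mulr0 nle_refl.
by rewrite (nle_pmul2r N).
Qed.

Lemma nle_mul x y x' y' : x <=| y -> x' <=| y' -> x * x' <=| y * y'.
Proof.
move=> xy xy'; apply: (nle_trans N) (nle_mul2r _ xy) _.
by rewrite mulrC [y * y']mulrC nle_mul2r.
Qed.

Lemma nlt_le_mul x y x' y' : y' != 0 -> x <| y -> x' <=| y' -> x * x' <| y * y'.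
Proof.
move=> y0 xy xy'; apply: (@nle_lt_trans (x * y')).
  by apply: nle_mul => //; apply: nle_refl.
by rewrite (nle_pmul2r N).
Qed.

Lemma nle_lt_mul x y x' y' : y != 0 -> x <=| y -> x' <| y' -> x * x' <| y * y'.
Proof. by rewrite [x * _]mulrC [y * _]mulrC => y0 xy xy'; apply: nlt_le_mul. Qed.

Lemma nlt_mul x y x' y' : x <| y -> x' <| y' -> x * x' <| y * y'.
Proof.
move=> xy xy'; apply: nlt_le_mul => //; first exact: nlt_neq0 xy'.
exact: nltW.
Qed.

Lemma nlt_pmul2r z x y : z != 0 -> (x * z <| y * z) = (x <| y).
Proof. by move=> z0; rewrite (nle_pmul2r N). Qed.

Lemma nle1N1 : -1 <=| 1.
Proof.
have n0 : (-1 : R) != 0 by rewrite oppr_eq0 oner_eq0.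
case/orP: (nle_total N (-1) 1) => // h.
by rewrite -(nle_pmul2r N _ _ n0) mulrNN mulr1 mul1r.
Qed.

Lemma nleNx x : - x <=| x.
Proof. by rewrite -{2}[x]mul1r -mulN1r nle_mul2r // nle1N1. Qed.

Lemma nleNr x y : (x <=| - y) = (x <=| y).
Proof.
apply/idP/idP => h; apply: (nle_trans N) h _; rewrite ?nleNx //.
by rewrite -{1}[y]opprK nleNx.
Qed.

Lemma nltD x y z : x <| z -> y <| z -> x + y <| z.
Proof.
move=> xz yz; case/orP: (nle_total N x y) => h.
  by apply: nle_lt_trans yz; apply: (nleD N) => //; apply: nle_refl.
by apply: nle_lt_trans xz; apply: (nleD N) => //; apply: nle_refl.
Qed.

Lemma nltB x y z : x <| z -> y <| z -> x - y <| z.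
Proof. by move=> xz yz; apply: nltD => //; rewrite nleNr. Qed.

Lemma nlt_distC x y z : (x - y <| z) = (y - x <| z).
Proof. by rewrite -[in LHS]nleNr opprB. Qed.

Lemma nle_sum (I : Type) (r : seq I) (P : pred I) (F : I -> R) z :
  (forall i, P i -> F i <=| z) -> \sum_(i <- r | P i) F i <=| z.
Proof.
move=> h; apply: (big_ind (fun x => x <=| z)) => //; first exact: nle0x.
by move=> x y; apply: (nleD N).
Qed.

Lemma nlt_sum (I : Type) (r : seq I) (P : pred I) (F : I -> R) z : z != 0 ->
  (forall i, P i -> F i <| z) -> \sum_(i <- r | P i) F i <| z.
Proof.
move=> z0 h; apply: (big_ind (fun x => x <| z)) => //; first by rewrite nlt0x.
by move=> x y; apply: nltD.
Qed.

Definition nsame x y := le x y && le y x.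
Local Notation "x ~| y" := (nsame x y) (at level 70, no associativity).

Lemma nsame_refl x : x ~| x.
Proof. by rewrite /nsame nle_refl. Qed.

Lemma nsame_sym x y : (x ~| y) = (y ~| x).
Proof. by rewrite /nsame andbC. Qed.

Lemma nsame_lel x y z : x ~| y -> (x <=| z) = (y <=| z).
Proof. by case/andP=> xy yx; apply/idP/idP; apply: (nle_trans N). Qed.

Lemma nsame_ler x y z : x ~| y -> (z <=| x) = (z <=| y).
Proof.
by case/andP=> xy yx; apply/idP/idP => h; apply: (nle_trans N) h _.
Qed.

Lemma nsame_trans y x z : x ~| y -> y ~| z -> x ~| z.
Proof. by move=> xy yz; rewrite /nsame (nsame_lel _ xy) (nsame_ler _ xy). Qed.

Lemma nsame_mul x y x' y' : x ~| y -> x' ~| y' -> x * x' ~| y * y'.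
Proof.
by case/andP=> a b /andP[c d]; rewrite /nsame !nle_mul.
Qed.

Lemma nsame_pmul2r z x y : z != 0 -> (x * z ~| y * z) = (x ~| y).
Proof. by move=> z0; rewrite /nsame !(nle_pmul2r N). Qed.

Lemma nsame0 x y : x ~| y -> (x == 0) = (y == 0).
Proof. by move=> h; rewrite -[_ == _]negbK -[y == 0]negbK -!nlt0x (nsame_lel _ h). Qed.

(** The isosceles principle: in a triangle the two longest sides have the same
    size. *)
Lemma nsame_dist x y : x - y <| y -> x ~| y.
Proof.
move=> h; have xy : x <=| y.
  by rewrite -(subrK y x) (nleD N) ?nle_refl // nltW.
rewrite /nsame xy /=; apply/negPn/negP => yx.
suff : y <| y by rewrite nle_refl.
by have := nltB yx h; rewrite opprB addrC subrK.
Qed.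

Lemma nsame_addl x y : x <| y -> x + y ~| y.
Proof. by move=> h; apply: nsame_dist; rewrite addrK. Qed.

Lemma nsame_addr x y : x <| y -> y + x ~| y.
Proof. by move=> h; rewrite addrC nsame_addl. Qed.

Lemma nle_pow n x y : x <=| y -> x ^+ n <=| y ^+ n.
Proof.
move=> xy; elim: n => [|n IH]; first by rewrite !expr0 nle_refl.
by rewrite !exprS nle_mul.
Qed.

Lemma nlt_pow n x y : x <| y -> x ^+ n.+1 <| y ^+ n.+1.
Proof.
move=> xy; elim: n => [|n IH]; first by rewrite !expr1.
by rewrite (exprS x) (exprS y); apply: nlt_mul.
Qed.

Lemma nle_powE n x y : (x ^+ n.+1 <=| y ^+ n.+1) = (x <=| y).
Proof.
apply/idP/idP => [|xy]; last exact: nle_pow.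
by apply: contraTT; apply: nlt_pow.
Qed.

(** Square roots are geometric means; this is the source of density of the
    values of an algebraically closed field. *)
Lemma nlt_sqrt x y z : x != 0 -> z ^+ 2 = x * y -> x <| y -> x <| z /\ z <| y.
Proof.
move=> x0 zE xy; have y0 := nlt_neq0 xy; split; rewrite -(nle_powE 1) zE expr2.
  by rewrite [x * y]mulrC (nle_pmul2r N).
by rewrite (nle_pmul2r N).
Qed.

End NormTheory.

(** * Valuation rings *)

(** Totality puts [1] and [-1] in [A], as they are their own inverses. *)
Record valring (K : fieldType) (A : set K) : Prop := ValRing {
  vr_add : forall x y, A x -> A y -> A (x + y);
  vr_mul : forall x y, A x -> A y -> A (x * y);
  vr_total : forall x, A x \/ A x^-1
}.

(** The maximal ideal of [A]; that its elements lie in [A] follows from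
    totality. *)
Definition vmax (K : fieldType) (A : set K) : set K := [set x | x = 0 \/ ~ A x^-1].

Section ValRingTheory.
Variables (K : fieldType) (A : set K).
Hypothesis VA : valring A.

Lemma vr1 : A 1.
Proof. by case: (vr_total VA 1); rewrite ?invr1. Qed.

Lemma vrN1 : A (-1).
Proof. by case: (vr_total VA (-1)); rewrite ?invrN ?invr1. Qed.

Lemma vrN x : A x -> A (- x).
Proof. by move=> Ax; rewrite -mulN1r; apply: (vr_mul VA) => //; apply: vrN1. Qed.

Lemma vr0 : A 0.
Proof. by case: (vr_total VA 0); rewrite ?invr0. Qed.

Definition vle : rel K := fun x y => `[< exists2 c, A c & x = c * y >].

Lemma vleE x y : y != 0 -> vle x y = `[< A (x / y) >].
Proof.
move=> y0; apply/idP/idP => /asboolP h; apply/asboolP.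
  by case: h => c Ac ->; rewrite mulfK.
by exists (x / y); rewrite ?divfK.
Qed.

Lemma vle1 x : vle x 1 <-> A x.
Proof. by rewrite vleE ?oner_eq0 // divr1; split => [/asboolP|/asboolP]. Qed.

Lemma vlt1 x : ~~ vle 1 x <-> vmax A x.
Proof.
rewrite /vmax /=.
have [->|x0] := eqVneq x 0.
  split; first by left.
  by move=> _; apply/asboolP => -[c _]; rewrite mulr0; apply/eqP; rewrite oner_eq0.
rewrite vleE // div1r; split; first by move/asboolP; right.
by case => [/eqP|h]; [rewrite (negPf x0) | apply/asboolP].
Qed.

Lemma vle_norm : norm_rel vle.
Proof.
have le0 x : vle x 0 -> x = 0 by move=> /asboolP[c _ ->]; rewrite mulr0.
have ge0 x : vle 0 x by apply/asboolP; exists 0; rewrite ?mul0r //; apply: vr0.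
split=> //.
- move=> x y; have [->|y0] := eqVneq y 0; first by rewrite ge0 orbT.
  have [->|x0] := eqVneq x 0; first by rewrite ge0.
  rewrite !vleE //; case: (vr_total VA (x / y)); rewrite ?invf_div => h.
    by apply/orP; left; apply/asboolP.
  by apply/orP; right; apply/asboolP.
- move=> y x z /asboolP[c Ac ->] /asboolP[d Ad ->]; apply/asboolP.
  by exists (c * d); rewrite ?mulrA //; apply: (vr_mul VA).
- move=> z x y z0; have [->|y0] := eqVneq y 0.
    rewrite mul0r; apply/idP/idP => /le0.
      by move/eqP; rewrite mulf_eq0 (negPf z0) orbF => /eqP ->.
    by move=> ->; rewrite mul0r.
  by rewrite !vleE ?mulf_neq0 // -mulf_div divff // mulr1.
- move=> x y z /asboolP[c Ac ->] /asboolP[d Ad ->]; apply/asboolP.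
  by exists (c + d); rewrite ?mulrDl //; apply: (vr_add VA).
Qed.

End ValRingTheory.

(** * Extension of a valuation ring to a larger field *)

Section Chevalley.
Variables (K L : fieldType) (phi : {rmorphism K -> L}) (A : set K).
Hypothesis VA : valring A.

(** Chevalley's theorem takes a subring maximal among those in which the maximal
    ideal of [A] generates a proper ideal.  As [A] is a valuation ring, a finite
    combination of elements of its maximal ideal is a multiple of one of them,
    so that properness just says that the subring meets [K] in [A]. *)
Record lies_over (M : set L) : Prop := LiesOver {
  lo_sub : forall x y, M x -> M y -> M (x - y);
  lo_mul : forall x y, M x -> M y -> M (x * y);
  lo_trace : forall x, M (phi x) <-> A x
}.

Section LiesOver.
Variable M : set L.
Hypothesis GM : lies_over M.

Lemma lo1 : M 1.
Proof. by rewrite -(rmorph1 phi); apply/(lo_trace GM); apply: vr1. Qed.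

Lemma lo0 : M 0.
Proof. by rewrite -(rmorph0 phi); apply/(lo_trace GM); apply: vr0. Qed.

Lemma lo_add x y : M x -> M y -> M (x + y).
Proof.
move=> Mx My; rewrite -[y]opprK -[- y]sub0r.
by do 2?[apply: (lo_sub GM) => //]; apply: lo0.
Qed.

Lemma lo_exp x n : M x -> M (x ^+ n).
Proof.
move=> Mx; elim: n => [|n IH]; first by rewrite expr0; apply: lo1.
by rewrite exprS; apply: (lo_mul GM).
Qed.

Lemma lo_sum (I : Type) (r : seq I) (P : pred I) (F : I -> L) :
  (forall i, P i -> M (F i)) -> M (\sum_(i <- r | P i) F i).
Proof. by move=> h; apply: big_ind => //; [apply: lo0 | apply: lo_add]. Qed.

Lemma lo_proper m r : ~ A m^-1 -> M r -> phi m * r <> 1.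
Proof.
move=> Am Mr h; apply: Am; apply/(lo_trace GM).
suff -> : phi m^-1 = r by [].
have m0 : phi m != 0.
  by apply/eqP => m0; move: h; rewrite m0 mul0r => /esym/eqP; rewrite oner_eq0.
by rewrite fmorphV -[RHS](mulKf m0) h mulr1.
Qed.

Lemma lo_proper2 m m' r s : ~ A m^-1 -> ~ A m'^-1 -> M r -> M s ->
  phi m * r + phi m' * s <> 1.
Proof.
have main a b t u : ~ A a^-1 -> A (b / a) -> M t -> M u ->
    phi a * t + phi b * u <> 1.
  move=> Aa Aba Mt Mu h; apply: (@lo_proper a (t + phi (b / a) * u)) => //.
    by apply: lo_add => //; apply: (lo_mul GM) => //; apply/(lo_trace GM).
  have a0 : a != 0.
    by apply: contra_notN Aa => /eqP ->; rewrite invr0; apply: vr0.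
  by rewrite mulrDr mulrA -rmorphM (mulrC a (b / a)) divfK.
move=> Am Am' Mr Ms h.
case: (vr_total VA (m' / m)) => [h1|]; first exact: main h.
by rewrite invf_div => h1; apply: main h1 Ms Mr _ => //; rewrite addrC.
Qed.

Definition adjoin (z : L) : set L :=
  [set w | exists2 p : {poly L}, forall i, M p`_i & w = p.[z]].

Lemma adjoin_base z : M `<=` adjoin z.
Proof.
move=> x Mx; exists x%:P; last by rewrite hornerC.
by move=> i; rewrite coefC; case: eqP => // _; apply: lo0.
Qed.

Lemma adjoin_gen z : adjoin z z.
Proof.
exists 'X; last by rewrite hornerX.
by move=> i; rewrite coefX; case: eqP => _; [apply: lo1 | apply: lo0].
Qed.

Lemma adjoin_lies_over z : (forall y, adjoin z (phi y) -> A y) ->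
  lies_over (adjoin z).
Proof.
move=> h; split.
- move=> _ _ [p Mp ->] [q Mq ->]; exists (p - q); last by rewrite hornerD hornerN.
  by move=> i; rewrite coefB; apply: (lo_sub GM).
- move=> _ _ [p Mp ->] [q Mq ->]; exists (p * q); last by rewrite hornerM.
  by move=> i; rewrite coefM; apply: lo_sum => j _; apply: (lo_mul GM).
- by move=> x; split=> [|Ax]; [apply: h | apply: adjoin_base; apply/(lo_trace GM)].
Qed.

Hypothesis maxM : forall M', M `<` M' -> ~ lies_over M'.

(** Adjoining [z] must add to the trace on [K] some [y] outside [A], and [y^-1]
    is then in the maximal ideal. *)
Lemma max_relation z : ~ M z -> exists m (p : {poly L}),
  [/\ ~ A m^-1, forall i, M p`_i & phi m * p.[z] = 1].
Proof.
move=> Mz; apply: contrapT => no.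
apply: (maxM (M' := adjoin z)).
  by split=> [|h]; [apply: adjoin_base | apply/Mz/h/adjoin_gen].
apply: adjoin_lies_over => y [p Mp yE]; apply: contrapT => Ay; apply: no.
exists y^-1, p; rewrite invrK; split=> //.
rewrite -yE -rmorphM mulVf ?rmorph1 //.
by apply: contra_notN Ay => /eqP ->; apply: vr0.
Qed.

(** The maximal ideal of [A] lies in the Jacobson radical of a maximal subring.
    If the inverse of [u = 1 - m s] were missing, a relation for it, multiplied
    by a power of [u], would contradict [lo_proper2]. *)
Lemma max_unit m s : ~ A m^-1 -> M s ->
  1 - phi m * s != 0 /\ M (1 - phi m * s)^-1.
Proof.
move=> Am Ms; set u := 1 - _.
have u0 : u != 0.
  by rewrite subr_eq0 eq_sym; apply/eqP; apply: lo_proper.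
split=> //; apply: contrapT => /max_relation[m' [p [Am' Mp h]]].
(* All powers of [u] are congruent to [1] modulo the ideal. *)
have hN n : exists2 t, M t & u ^+ n = 1 - phi m * t.
  elim: n => [|n [t Mt IH]].
    by exists 0; [apply: lo0 | rewrite mulr0 subr0 expr0].
  exists (s + t - phi m * s * t); last by rewrite exprS IH /u; ring.
  have Mm : M (phi m).
    apply/(lo_trace GM); case: (vr_total VA m) => // h1.
  by apply: (lo_sub GM); [apply: lo_add | do 2?[apply: (lo_mul GM)=> //]].
have [t Mt tE] := hN (size p).
pose r := \sum_(i < size p) p`_i * u ^+ (size p - i).
apply: (@lo_proper2 m' m r t) => //.
  apply: lo_sum => i _; apply: (lo_mul GM) => //; apply: lo_exp.
  apply: (lo_sub GM); first exact: lo1.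
  apply: (lo_mul GM) => //.
  by apply/(lo_trace GM); case: (vr_total VA m).
suff -> : phi m' * r = u ^+ size p by rewrite tE subrK.
rewrite -[RHS]mulr1 -h horner_coef mulrCA; congr (_ * _).
rewrite big_distrr /=; apply: eq_bigr => i _.
rewrite mulrCA exprVn; congr (_ * _).
have -> : u ^+ size p = u ^+ (size p - i) * u ^+ i.
  by rewrite -exprD subnK // ltnW.
by rewrite mulfK // expf_neq0.
Qed.

Definition has_relation n z := exists m (p : {poly L}),
  [/\ ~ A m^-1, forall i, M p`_i, (size p <= n.+1)%N & phi m * p.[z] = 1].

(** The relation for [x^-1], whose constant term [u] can be moved to the left and
    inverted, expresses [x^n] by lower powers of [x] with coefficients in the
    ideal; substituting this in the relation for [x] lowers its degree. *)
Lemma relation_descent x n l : x != 0 -> (l <= n)%N ->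
  has_relation n x -> has_relation l x^-1 -> exists2 n', (n' < n)%N & has_relation n' x.
Proof.
move=> x0 ln [m [p [Am Mp sp pE]]] [m' [q [Am' Mq sq qE]]].
have n0 : (0 < n)%N.
  case: n sp {ln} => // /size1_polyC pC.
  by case: (lo_proper Am (Mp 0%N)); rewrite -[RHS]pE {2}pC hornerC.
have [] := max_unit Am' (Mq 0%N); set u := 1 - _ => u0 Mu.
pose r := \poly_(j < n) (q`_(n - j) / u).
have Mr i : M r`_i.
  rewrite coef_poly; case: ifP => _; last exact: lo0.
  exact: (lo_mul GM).
have rE : x ^+ n = phi m' * r.[x].
  apply: (mulIf u0); rewrite {1}/u mulrBr mulr1 -{1}[x ^+ n]mulr1 -qE.
  rewrite (@horner_coef_wide _ n.+1) ?(leq_trans sq) // big_ord_recl /=.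
  rewrite expr0 mulr1 mulrDr mulrDr mulrCA addrAC subrr add0r mulrCA -mulrA.
  congr (_ * _); rewrite horner_poly mulr_suml mulr_sumr.
  rewrite (reindex_inj rev_ord_inj) /=; apply: eq_bigr => i _.
  rewrite mulrAC divfK // mulrCA /bump leq0n add1n subnSK // exprVn.
  congr (_ * _).
  have -> : x ^+ n = x ^+ i * x ^+ (n - i) by rewrite -exprD subnKC // ltnW.
  by rewrite mulfK // expf_neq0.
have [n' nE] : exists n', n = n'.+1 by case: n n0 {ln sp r Mr rE} => // n' _; exists n'.
exists n'; first by rewrite nE.
pose p' := \poly_(j < n) p`_j.
have ppE : p.[x] = p'.[x] + p`_n * x ^+ n.
  by rewrite (@horner_coef_wide _ n.+1) // big_ord_recr /= horner_poly.
exists m, (p' + (p`_n * phi m') *: r); split=> //.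
- move=> i; rewrite coefD coefZ; apply: lo_add.
    by rewrite coef_poly; case: ifP => // _; apply: lo0.
  apply: (lo_mul GM) => //; apply: (lo_mul GM) => //.
  by apply/(lo_trace GM); case: (vr_total VA m').
- rewrite -nE (leq_trans (size_polyD _ _)) // geq_max size_poly /=.
  by rewrite (leq_trans (size_scale_leq _ _)) // size_poly.
- by rewrite hornerD hornerZ -mulrA -rE -ppE.
Qed.

(** If neither [x] nor [x^-1] belonged to a maximal subring, both would satisfy a
    relation, and [relation_descent] would lower the larger of the two degrees
    for ever. *)
Lemma max_valring : valring M.
Proof.
split; [exact: lo_add | exact: (lo_mul GM) | move=> x].
apply: contrapT => /not_orP[Mx Mx'].
have x0 : x != 0 by apply: contra_notN Mx => /eqP ->; apply: lo0.
have ex z : ~ M z -> exists n, has_relation n z.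
  by move=> /max_relation[m [p [? ? ?]]]; exists (size p), m, p; split.
have desc N y n l : (n + l < N)%N -> y != 0 -> has_relation n y ->
    has_relation l y^-1 -> False.
  elim: N y n l => // N IH y n l nlN y0 ny ly.
  have [ln|/ltnW nl] := leqP l n.
    have [n' n'n h] := relation_descent y0 ln ny ly.
    by apply: IH h ly; rewrite // -ltnS (leq_trans _ nlN) // ltnS ltn_add2r.
  have := @relation_descent y^-1 l n; rewrite invrK invr_eq0 => hh.
  have [l' l'l h] := hh y0 nl ly ny.
  by apply: IH ny h; rewrite // -ltnS (leq_trans _ nlN) // ltnS ltn_add2l.
have [n nx] := ex _ Mx; have [l lx] := ex _ Mx'.
exact: desc (ltnSn _) x0 nx lx.
Qed.

End LiesOver.

(** The empty set is admitted in the application of Zorn's lemma, as it is the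
    union of the empty chain. *)
Lemma valring_extend : exists2 B : set L, valring B & forall x, B (phi x) <-> A x.
Proof.
pose P (M : set L) := M = set0 \/ lies_over M.
have P0 : lies_over (phi @` A).
  split.
  - move=> _ _ [x Ax <-] [y Ay <-]; exists (x - y); rewrite ?rmorphB //.
    by apply: (vr_add VA) => //; apply: vrN.
  - move=> _ _ [x Ax <-] [y Ay <-]; exists (x * y); rewrite ?rmorphM //.
    exact: (vr_mul VA).
  - by move=> x; split=> [[y Ay /fmorph_inj <-] //|Ax]; exists x.
have [|M [PM maxM]] := @Zorn_bigcup L P.
- move=> F FP Ftot.
  have [[M FM M0]|none] := pselect (exists2 M, F M & M !=set0); last first.
    left; apply/seteqP; split => // x [M FM Mx]; apply: none.
    by exists M => //; exists x.
  have lo X x : F X -> X x -> lies_over X.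
    by move=> /FP[->|//].
  have up x y : (\bigcup_(X in F) X) x -> (\bigcup_(X in F) X) y ->
      exists X, [/\ F X, X x & X y].
    move=> [X FX Xx] [Y FY Yy]; case: (Ftot _ _ FX FY) => h.
      by exists Y; split => //; apply: h.
    by exists X; split => //; apply: h.
  right; split.
  - move=> x y /up h /h[X [FX Xx Xy]]; exists X => //.
    exact: (lo_sub (lo _ _ FX Xx)).
  - move=> x y /up h /h[X [FX Xx Xy]]; exists X => //.
    exact: (lo_mul (lo _ _ FX Xx)).
  - move=> x; split=> [[X FX Xx]|Ax].
      exact/(lo_trace (lo _ _ FX Xx)).
    by case: M0 => y My; exists M => //; apply/(lo_trace (lo _ _ FM My)).
have GM : lies_over M.
  case: PM => // M0; case: (maxM (phi @` A)); last by right.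
  rewrite M0; split => // /(_ (phi 1)); apply; exists 1 => //.
  exact: vr1.
exists M; last exact: (lo_trace GM).
apply: (max_valring GM) => M' MM' h; apply: (maxM M') => //; by right.
Qed.

End Chevalley.

(** * The Gauss norm refined by the order of vanishing *)

Section Gauss.
Variables (R : idomainType) (le : rel R).
Hypothesis N : norm_rel le.

Local Notation "x <=| y" := (le x y) (at level 70, no associativity).
Local Notation "x <| y" := (~~ le y x) (at level 70, no associativity).
Local Notation "x ~| y" := (nsame le x y) (at level 70, no associativity).

Implicit Types P Q : {poly R}.

Definition first_max P i :=
  (forall j, P`_j <=| P`_i) /\ (forall j, (j < i)%N -> P`_j <| P`_i).

Lemma nle_arg_max (u : nat -> R) n :
  exists i, forall j, (j < n)%N -> u j <=| u i.
Proof.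
elim: n => [|n [i IH]]; first by exists 0%N.
case/orP: (nle_total N (u n) (u i)) => h.
  by exists i => j; rewrite ltnS leq_eqVlt => /orP[/eqP -> //|]; apply: IH.
exists n => j; rewrite ltnS leq_eqVlt => /orP[/eqP ->|]; first exact: nle_refl.
by move=> /IH jx; apply: (nle_trans N) jx h.
Qed.

Lemma first_max_ex P : exists i, first_max P i.
Proof.
have ex : exists i, `[< forall j, P`_j <=| P`_i >].
  have [i hi] := nle_arg_max (fun j => P`_j) (size P).
  exists i; apply/asboolP => j; have [|h] := ltnP j (size P); first exact: hi.
  by rewrite nth_default // nle0x.
case: (ex_minnP ex) => i /asboolP Pi mini; exists i; split=> // j ji.
apply/negP => ij; move: ji; rewrite ltnNge mini //; apply/asboolP => l.
by apply: (nle_trans N) ij.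
Qed.

Lemma first_max_uniq P i j : first_max P i -> first_max P j -> i = j.
Proof.
move=> [i1 i2] [j1 j2]; case: (ltngtP i j) => //.
  by move=> /j2; rewrite i1.
by move=> /i2; rewrite j1.
Qed.

(** The order of vanishing at [0] of the reduction of [P], scaled to have Gauss
    norm one. *)
Definition gauss_index P : nat := xget 0%N [set i | first_max P i].

Lemma gauss_indexP P : first_max P (gauss_index P).
Proof. by have [i iP] := first_max_ex P; apply: (@xgetI _ 0%N _ i iP). Qed.

Lemma gauss_indexE P i : first_max P i -> gauss_index P = i.
Proof. exact: first_max_uniq (gauss_indexP P). Qed.

Lemma gauss_index_neq0 P : P != 0 -> P`_(gauss_index P) != 0.
Proof.
move=> P0; apply: (nle_neq0 N) (_ : lead_coef P <=| _) _.
  by case: (gauss_indexP P) => + _; apply.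
by rewrite lead_coef_eq0.
Qed.

(** Compares first the Gauss norms, then the indices: the variable has a size
    that is smaller than [1] but larger than all smaller values. *)
Definition gauss_le P Q : bool :=
  (P`_(gauss_index P) <| Q`_(gauss_index Q)) ||
  (P`_(gauss_index P) <=| Q`_(gauss_index Q)) && (gauss_index Q <= gauss_index P)%N.

(** This form depends on [P] through all its coefficients but not through its
    index, which makes stability under addition immediate. *)
Lemma gauss_leP P Q : gauss_le P Q <-> forall j,
  (P`_j <=| Q`_(gauss_index Q)) /\ ((j < gauss_index Q)%N -> P`_j <| Q`_(gauss_index Q)).
Proof.
have [p1 p2] := gauss_indexP P; split=> [/orP[h j|/andP[h qp] j]|h].
- have h' := nle_lt_trans N (p1 j) h.
  by split=> [|_ //]; apply: (nltW N).
- split=> [|jq]; first exact: (nle_trans N) (p1 j) h.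
  by apply: (nlt_le_trans N) h; apply: p2; apply: leq_trans qp.
- rewrite /gauss_le; have [-> /=] := h (gauss_index P).
  by case: ltnP => [_ /(_ isT) ->|_ _]; rewrite ?orbT.
Qed.

(** Gauss's lemma: in the coefficient of degree [i + j] the product of the two
    first maximal coefficients strictly dominates all the other terms. *)
Lemma first_max_mul P Q i j : P != 0 -> Q != 0 ->
  first_max P i -> first_max Q j ->
  first_max (P * Q) (i + j) /\ (P * Q)`_(i + j) ~| P`_i * Q`_j.
Proof.
move=> P0 Q0 mi mj.
have Pi0 : P`_i != 0 by rewrite -(gauss_indexE mi) gauss_index_neq0.
have Qj0 : Q`_j != 0 by rewrite -(gauss_indexE mj) gauss_index_neq0.
have PQ0 : P`_i * Q`_j != 0 by rewrite mulf_neq0.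
case: mi mj => [i1 i2] [j1 j2].
have up u v : P`_u * Q`_v <=| P`_i * Q`_j by apply: nle_mul.
have ups u v : (u < i)%N || (v < j)%N -> P`_u * Q`_v <| P`_i * Q`_j.
  by case/orP=> h; [apply: (nlt_le_mul N) => //; apply: i2
    | apply: (nle_lt_mul N) => //; apply: j2].
have E : (P * Q)`_(i + j) ~| P`_i * Q`_j.
  have hi : (i < (i + j).+1)%N by rewrite ltnS leq_addr.
  rewrite coefM (bigD1 (Ordinal hi)) //=.
  have -> : (i + j - i)%N = j by lia.
  apply: (nsame_addr N); apply: (nlt_sum N) => // u; rewrite -val_eqE /= => ui.
  by apply: ups; move: (ltn_ord u) ui => /=; lia.
split=> //; split=> l; rewrite (nsame_ler N _ E, nsame_lel N _ E) coefM.
  by apply: (nle_sum N).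
move=> lij; apply: (nlt_sum N) => // u _; apply: ups.
by move: (ltn_ord u); lia.
Qed.

Lemma gauss_index_mul P Q : P != 0 -> Q != 0 ->
  gauss_index (P * Q) = (gauss_index P + gauss_index Q)%N.
Proof.
by move=> P0 Q0; apply: gauss_indexE; case: (first_max_mul P0 Q0 (gauss_indexP P) (gauss_indexP Q)).
Qed.

Lemma gauss_coef_mul P Q : P != 0 -> Q != 0 ->
  (P * Q)`_(gauss_index (P * Q)) ~| P`_(gauss_index P) * Q`_(gauss_index Q).
Proof.
move=> P0 Q0; rewrite gauss_index_mul //.
by case: (first_max_mul P0 Q0 (gauss_indexP P) (gauss_indexP Q)).
Qed.

Lemma gauss_le_norm : norm_rel gauss_le.
Proof.
split.
- move=> P Q; rewrite /gauss_le.
  case/orP: (nle_total N P`_(gauss_index P) Q`_(gauss_index Q)) => h; rewrite h /=;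
  by case: (boolP (_ <=| _)) => //=; rewrite ?orbT // leq_total.
- move=> Q P S /gauss_leP h1 /gauss_leP h2; apply/gauss_leP => j.
  have [a b] := h1 j; have [c d] := h2 (gauss_index Q).
  split=> [|js]; first exact: (nle_trans N) a c.
  have [jq|qj] := ltnP j (gauss_index Q); first exact: (nlt_le_trans N) (b jq) c.
  by apply: (nle_lt_trans N) a _; apply: d; apply: leq_ltn_trans js.
- move=> T P Q T0; have [->|P0] := eqVneq P 0.
    rewrite mul0r; have g Q' : gauss_le 0 Q'.
      apply/gauss_leP => j; rewrite coef0 nle0x //; split=> // jq.
      case: (gauss_indexP Q') => _ /(_ _ jq); apply: (nle_lt_trans N); exact: nle0x.
    by rewrite !g.
  have [->|Q0] := eqVneq Q 0.
    have g Q' : gauss_le Q' 0 = (Q' == 0).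
      apply/idP/eqP => [/gauss_leP h|->]; last first.
        by rewrite /gauss_le leqnn nle_refl // orbT.
      apply/polyP => j; rewrite coef0; apply: (nle0 N).
      by have [] := h j; rewrite coef0.
    by rewrite mul0r !g mulf_eq0 (negPf T0) orbF.
  rewrite /gauss_le.
  rewrite (nsame_lel N _ (gauss_coef_mul P0 T0)) (nsame_lel N _ (gauss_coef_mul Q0 T0)).
  rewrite (nsame_ler N _ (gauss_coef_mul P0 T0)) (nsame_ler N _ (gauss_coef_mul Q0 T0)).
  by rewrite !(nle_pmul2r N) ?gauss_index_neq0 // !gauss_index_mul // leq_add2r.
- move=> P Q S /gauss_leP h1 /gauss_leP h2; apply/gauss_leP => j; rewrite coefD.
  have [a b] := h1 j; have [c d] := h2 j.
  by split=> [|js]; [apply: (nleD N) | apply: (nltD N); auto].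
- move=> P /gauss_leP h; apply/polyP => j; rewrite coef0; apply: (nle0 N).
  by have [] := h j; rewrite coef0.
Qed.

Lemma gauss_indexC c : gauss_index c%:P = 0%N.
Proof.
apply: gauss_indexE; split=> [i|//]; rewrite !coefC /=.
by case: eqP => _; [apply: nle_refl | apply: nle0x].
Qed.

Lemma gauss_leC c d : gauss_le c%:P d%:P = (c <=| d).
Proof.
by rewrite /gauss_le !gauss_indexC !coefC /= andbT orb_idl // => /(nltW N).
Qed.

Lemma gauss_leC_gt P c i : c <| P`_i -> ~~ gauss_le P c%:P.
Proof.
move=> ci; apply/negP => /gauss_leP /(_ i)[+ _].
by rewrite gauss_indexC coefC eqxx; apply/negP.
Qed.

Lemma gauss_leC_lt P c : P`_(gauss_index P) <| c -> ~~ gauss_le c%:P P.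
Proof.
move=> ci; apply/negP => /gauss_leP /(_ 0%N)[+ _].
by rewrite coefC eqxx; apply/negP.
Qed.

Lemma gauss_le_anti P Q : gauss_le P Q -> gauss_le Q P -> gauss_index P = gauss_index Q.
Proof.
rewrite /gauss_le; have := nle_total N P`_(gauss_index P) Q`_(gauss_index Q).
case: (P`_(gauss_index P) <=| _) => /=; case: (Q`_(gauss_index Q) <=| _) => //= _ a b.
by apply/eqP; rewrite eqn_leq a b.
Qed.

(** Such polynomials behave like their constant term, both for the refined Gauss
    norm and when evaluated at integral elements. *)
Definition dominant0 P := forall j, (0 < j)%N -> P`_j <| P`_0.

Lemma dominant0_index P : dominant0 P -> gauss_index P = 0%N.
Proof.
move=> h; apply: gauss_indexE; split=> // -[|j]; first exact: nle_refl.
by apply: (nltW N); apply: h.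
Qed.

Lemma dominant0C c : c != 0 -> dominant0 c%:P.
Proof. by move=> c0 [|j] // _; rewrite !coefC /= (nlt0x N). Qed.

Lemma dominant0_linear a c : c <| a -> dominant0 (a%:P + c *: 'X).
Proof.
move=> ca [|[|j]] // _; rewrite !coefD !coefC !coefZ !coefX /= ?(mulr0, mulr1, addr0, add0r) //.
by rewrite (nlt0x N); apply: (nlt_neq0 N) ca.
Qed.

Lemma dominant0_neq0 P : dominant0 P -> P`_0 != 0.
Proof. by move=> /(_ 1%N isT); apply: (nlt_neq0 N). Qed.

Lemma dominant0M P Q : dominant0 P -> dominant0 Q -> dominant0 (P * Q).
Proof.
move=> hP hQ j j0; have P0 := dominant0_neq0 hP; have Q0 := dominant0_neq0 hQ.
have up S i : dominant0 S -> S`_i <=| S`_0.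
  move=> h; case: i => [|i]; first by apply: nle_refl.
  by apply: (nltW N); apply: h.
rewrite coefM coefM big_ord1 /=; apply: (nlt_sum N); first by rewrite mulf_neq0.
move=> [[|i] ij] _ /=.
  by rewrite !subn0; apply: (nle_lt_mul N) => //; [apply: nle_refl | apply: hQ].
by rewrite subnn; apply: (nlt_le_mul N) => //; [apply: hP | apply: up].
Qed.

Lemma dominant0_horner P z : dominant0 P -> z <=| 1 -> P.[z] - P`_0 <| P`_0.
Proof.
move=> h z1; have P0 := dominant0_neq0 h.
have sP : (0 < size P)%N by rewrite size_poly_gt0; apply: contra_neq P0 => ->; rewrite coef0.
rewrite (@horner_coef_wide _ (size P).-1.+1); last by rewrite prednK.
rewrite big_ord_recl /= expr0 mulr1.
rewrite addrC addKr; apply: (nlt_sum N) => // i _.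
rewrite -[X in _ <| X]mulr1; apply: (nlt_le_mul N); rewrite ?oner_eq0 //.
  exact: h.
by rewrite -(expr1n _ (bump 0 i)) nle_pow.
Qed.

End Gauss.

(** * Places of a field of fractions *)

Lemma norm_pullback (D R : idomainType) (h : {rmorphism D -> R}) (le : rel R) :
  norm_rel le -> (forall x, h x = 0 -> x = 0) -> norm_rel (fun x y => le (h x) (h y)).
Proof.
move=> N inj; split=> /=.
- by move=> x y; apply: (nle_total N).
- by move=> y x z; apply: (nle_trans N).
- move=> z x y z0; rewrite !rmorphM (nle_pmul2r N) //.
  by apply: contra z0 => /eqP/inj ->.
- by move=> x y z; rewrite rmorphD; apply: (nleD N).
- by move=> x; rewrite rmorph0 => /(nle0 N)/inj.
Qed.

(** The residue field of [A] is [k]: the map from [k] to it is injective because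
    nonzero constants are units of [A], and surjective by [pl_rat]. *)
Record place (k K : fieldType) (i : k -> K) (A : set K) : Prop := Place {
  pl_valring : valring A;
  pl_triv : forall l, A (i l);
  pl_rat : forall x, A x -> exists l, vmax A (x - i l)
}.

(** A valuation of a domain extends uniquely to its field of fractions, here
    given as a field [K] generated by the image of the domain. *)
Section FracRing.
Variables (D : idomainType) (K : fieldType) (ev : {rmorphism D -> K}).
Hypothesis ev_inj : forall P, ev P = 0 -> P = 0.
Hypothesis ev_gen : forall z, exists P Q, ev Q != 0 /\ z = ev P / ev Q.
Variable le : rel D.
Hypothesis N : norm_rel le.

Definition frac_ring : set K :=
  [set z | exists P Q, [/\ Q != 0, z = ev P / ev Q & le P Q]].

Lemma ev_eq0 P : (ev P == 0) = (P == 0).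
Proof. by apply/eqP/eqP => [/ev_inj|->] //; rewrite rmorph0. Qed.

Lemma frac_ringE P Q : Q != 0 -> frac_ring (ev P / ev Q) <-> le P Q.
Proof.
move=> Q0; split=> [[P' [Q' [Q'0 /eqP h le']]]|]; last by exists P, Q.
rewrite eqr_div ?ev_eq0 // -!rmorphM -subr_eq0 -rmorphB ev_eq0 subr_eq0 in h.
rewrite -(nle_pmul2r N _ _ Q'0) (eqP h) [Q * _]mulrC.
by rewrite (nle_pmul2r N).
Qed.

Lemma frac_vmaxE P Q : Q != 0 -> vmax frac_ring (ev P / ev Q) <-> ~~ le Q P.
Proof.
move=> Q0; have [->|P0] := eqVneq P 0.
  rewrite rmorph0 mul0r (nlt0x N) Q0; split=> // _; by left.
rewrite /vmax /= invf_div frac_ringE //; split; last by move/negP; right.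
case=> [/eqP|/negP //]; by rewrite mulf_eq0 invr_eq0 !ev_eq0 (negPf P0) (negPf Q0).
Qed.

Lemma frac_gen z : exists P Q, Q != 0 /\ z = ev P / ev Q.
Proof.
by have [P [Q [Q0 ->]]] := ev_gen z; exists P, Q; rewrite -ev_eq0.
Qed.

Lemma frac_valring : valring frac_ring.
Proof.
split.
- move=> _ _ [P [Q [Q0 -> PQ]]] [P' [Q' [Q'0 -> PQ']]].
  rewrite addf_div ?ev_eq0 // -!rmorphM -rmorphD frac_ringE ?mulf_neq0 //.
  apply: (nleD N); first by rewrite (nle_pmul2r N).
  by rewrite [Q * Q']mulrC (nle_pmul2r N).
- move=> _ _ [P [Q [Q0 -> PQ]]] [P' [Q' [Q'0 -> PQ']]].
  by rewrite mulf_div -!rmorphM frac_ringE ?mulf_neq0 // nle_mul.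
- move=> z; have [P [Q [Q0 ->]]] := frac_gen z.
  have [->|P0] := eqVneq P 0.
    left; rewrite frac_ringE //; exact: nle0x.
  rewrite invf_div !frac_ringE //.
  by apply/orP; apply: (nle_total N).
Qed.

Lemma frac_place (k : fieldType) (i : k -> K) (iD : k -> D) :
  (forall l, ev (iD l) = i l) -> (forall l, le (iD l) 1) ->
  (forall P Q, Q != 0 -> le P Q -> exists l, ~~ le Q (P - iD l * Q)) ->
  place i frac_ring.
Proof.
move=> iE i1 res; split; first exact: frac_valring.
  by move=> l; rewrite -iE -[ev _]divr1 -(rmorph1 ev) frac_ringE ?oner_eq0.
move=> _ [P [Q [Q0 -> PQ]]]; have [l hl] := res P Q Q0 PQ; exists l.
suff -> : ev P / ev Q - i l = ev (P - iD l * Q) / ev Q by rewrite frac_vmaxE.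
by rewrite rmorphB rmorphM mulrBl mulfK ?ev_eq0 // iE.
Qed.

End FracRing.

(** * Substitution of a linear polynomial *)

Section LinearSubstitution.
Variables (L : closedFieldType) (le : rel L).
Hypothesis N : norm_rel le.
Local Notation "x <=| y" := (le x y) (at level 70, no associativity).
Local Notation "x <| y" := (~~ le y x) (at level 70, no associativity).
Local Notation "x ~| y" := (nsame le x y) (at level 70, no associativity).

Lemma linear_comp (b u a : L) :
  ('X - a%:P) \Po (b%:P + u *: 'X) = (b - a)%:P + u *: 'X.
Proof. by rewrite comp_polyB comp_polyX comp_polyC addrAC rmorphB. Qed.

Lemma coef0_linear_comp (p : {poly L}) b u :
  (p \Po (b%:P + u *: 'X))`_0 = p.[b].
Proof. by rewrite -horner_coef0 horner_comp !hornerE. Qed.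

Lemma horner1_linear_comp (p : {poly L}) b u :
  (p \Po (b%:P + u *: 'X)).[1] = p.[b + u].
Proof. by rewrite horner_comp !hornerE. Qed.

Definition rootsL (p : {poly L}) : seq L := sval (closed_field_poly_normal p).

Lemma rootsLE (p : {poly L}) : p = lead_coef p *: \prod_(z <- rootsL p) ('X - z%:P).
Proof. by rewrite /rootsL; case: closed_field_poly_normal. Qed.

Lemma mem_rootsL (p : {poly L}) a : p != 0 -> (a \in rootsL p) = root p a.
Proof.
by move=> p0; rewrite [X in root X a](rootsLE p) rootZ ?lead_coef_eq0 // root_prod_XsubC.
Qed.

(** A linear factor [X - a] becomes [(b - a) + u Y], and dominance of the
    constant term is stable under products. *)
Lemma dominant0_comp (p : {poly L}) b u : p != 0 ->
  (forall a, root p a -> u <| b - a) ->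
  dominant0 le (p \Po (b%:P + u *: 'X)).
Proof.
move=> p0 h; have E := rootsLE p; have rsE a := @mem_rootsL p a p0.
move: (rootsL p) E rsE => rs E rsE.
rewrite E comp_polyZ -mul_polyC rmorph_prod /=.
apply: (dominant0M N); first by apply: (dominant0C N); rewrite lead_coef_eq0.
have {}h : forall a, a \in rs -> u <| b - a by move=> a; rewrite rsE; apply: h.
elim: rs {E rsE} h => [_|a rs IH h].
  by rewrite big_nil; apply: (dominant0C N); rewrite oner_eq0.
rewrite big_cons; apply: (dominant0M N).
  by rewrite linear_comp; apply: (dominant0_linear N); apply: h; rewrite mem_head.
by apply: IH => a' a'rs; apply: h; rewrite inE a'rs orbT.
Qed.

Lemma horner_close (p : {poly L}) b x : p != 0 ->
  (forall a, root p a -> x - b <| b - a) -> p.[x] ~| p.[b].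
Proof.
move=> p0 /(dominant0_comp p0)/(dominant0_horner N) /(_ (nle_refl N 1)).
rewrite horner1_linear_comp coef0_linear_comp [b + _]addrC subrK.
exact: nsame_dist.
Qed.

End LinearSubstitution.

(** * Perturbing a place of a simple transcendental extension *)

Section Perturbation.
Variables (k F K : fieldType) (L : closedFieldType).
Variables (j : {rmorphism k -> F}) (f : {rmorphism F -> K}) (phi : {rmorphism K -> L}).
Variable X : K.
Variable le : rel L.
Hypothesis N : norm_rel le.

Local Notation "x <=| y" := (le x y) (at level 70, no associativity).
Local Notation "x <| y" := (~~ le y x) (at level 70, no associativity).
Local Notation "x ~| y" := (nsame le x y) (at level 70, no associativity).

Let ev : {rmorphism {poly F} -> K} := horner_eval X \o map_poly f.
Let psi : {rmorphism F -> L} := phi \o f.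
Let xi := phi X.
Let lift (P : {poly F}) : {poly L} := map_poly psi P.

Hypothesis ev_inj : forall P, ev P = 0 -> P = 0.
Hypothesis ev_gen : forall z, exists P Q, ev Q != 0 /\ z = ev P / ev Q.
Hypothesis res : forall z, phi z <=| 1 -> exists l, phi z - psi (j l) <| 1.
Hypothesis triv : forall l, psi (j l) <=| 1.

Lemma phi_ev P : phi (ev P) = (lift P).[xi].
Proof. by rewrite /ev /= /horner_eval -horner_map -map_poly_comp. Qed.

Lemma lift_eq0 P : (lift P == 0) = (P == 0).
Proof. exact: map_poly_eq0. Qed.

Section Substitution.
Variables (b c : L).
Hypothesis c0 : c != 0.

Definition recenter : {poly F} -> {poly L} := comp_poly (b%:P + c *: 'X) \o map_poly psi.
HB.instance Definition _ := GRing.RMorphism.on recenter.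

Lemma recenter_eq0 P : recenter P = 0 -> P = 0.
Proof.
move=> /eqP; rewrite /recenter /= comp_poly2_eq0 ?lift_eq0 => [/eqP //|].
rewrite addrC size_polyDl size_scale // size_polyX //.
by rewrite (leq_ltn_trans (size_polyC_leq1 _)).
Qed.

Definition recenter_le : rel {poly F} := fun P Q => gauss_le le (recenter P) (recenter Q).

Lemma recenter_le_norm : norm_rel recenter_le.
Proof. exact: norm_pullback (gauss_le_norm N) recenter_eq0. Qed.

Lemma recenter_le_const l : recenter_le (j l)%:P 1.
Proof.
rewrite /recenter_le /recenter /= map_polyC rmorph1 /= comp_polyC.
rewrite -[X in comp_poly _ X]/1%:P comp_polyC.
by rewrite (gauss_leC N) triv.
Qed.

(** For such [P], neither moving from [b] to [X] nor adding [c Y] to [b] changes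
    the size of any linear factor, hence of [P]. *)
Definition far (P : {poly F}) := forall a, root (lift P) a ->
  (xi - b <| b - a) && (c <| b - a).

Lemma recenter_far (g : {poly F}) : g != 0 -> far g ->
  gauss_index le (recenter g) = 0%N /\ (recenter g)`_0 ~| phi (ev g).
Proof.
move=> g0 hg; rewrite /recenter /= coef0_linear_comp; split.
  apply: (dominant0_index N); apply: (dominant0_comp N); rewrite ?lift_eq0 // => a ga.
  by have /andP[] := hg a ga.
rewrite nsame_sym phi_ev; apply: (horner_close N); rewrite ?lift_eq0 // => a ga.
by have /andP[] := hg a ga.
Qed.

Lemma recenter_le_far (g h : {poly F}) : g != 0 -> h != 0 -> far g -> far h ->
  recenter_le g h = (phi (ev g) <=| phi (ev h)).
Proof.
move=> g0 h0 gQ hQ; rewrite /recenter_le /gauss_le.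
have [-> eg] := recenter_far g0 gQ; have [-> eh] := recenter_far h0 hQ.
rewrite (nsame_lel N _ eg) (nsame_ler N _ eh) (nsame_lel N _ eh) (nsame_ler N _ eg).
by rewrite leqnn andbT orb_idl // => /(nltW N).
Qed.

Variable Q : {poly F}.
Hypothesis Q0 : Q != 0.
Hypothesis Qb : root (lift Q) b.
Hypothesis Qmin : forall (g : {poly F}) a, g != 0 -> (size g < size Q)%N ->
  root (lift g) a -> (xi - b <| b - a) && (c <| b - a).

Lemma recenter_small (g : {poly F}) : g != 0 -> (size g < size Q)%N ->
  gauss_index le (recenter g) = 0%N /\ (recenter g)`_0 ~| phi (ev g).
Proof. by move=> g0 gQ; apply: recenter_far => // a; apply: Qmin. Qed.

Lemma recenter_le_small (g h : {poly F}) : g != 0 -> h != 0 -> (size g < size Q)%N ->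
  (size h < size Q)%N -> recenter_le g h = (phi (ev g) <=| phi (ev h)).
Proof. by move=> g0 h0 gQ hQ; apply: recenter_le_far => // a; apply: Qmin. Qed.

(** The factor [X - b] of [Q] becomes [c Y]. *)
Lemma gauss_index_recenter_gt0 : (0 < gauss_index le (recenter Q))%N.
Proof.
have /factor_theorem[q qE] := Qb.
have q0 : q != 0.
  by apply: contra_neq Q0 => q0; apply/eqP; rewrite -lift_eq0 qE q0 mul0r.
rewrite /recenter /= -/(lift Q) qE comp_polyM linear_comp subrr add0r.
have s0 : (q \Po (b%:P + c *: 'X)) != 0.
  rewrite comp_poly2_eq0 // addrC size_polyDl size_scale // size_polyX //.
  by rewrite (leq_ltn_trans (size_polyC_leq1 _)).
have X0 : c *: 'X != 0 by rewrite scaler_eq0 negb_or c0 polyX_eq0.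
rewrite (gauss_index_mul N) // (_ : gauss_index le (c *: 'X) = 1%N) ?addn1 //.
apply: (gauss_indexE N); split=> -[|[|i]] //=;
  rewrite !coefZ !coefX /= ?mulr0 ?mulr1 ?(nle0x N) ?(nlt0x N) ?nle_refl //.
Qed.

Lemma recenter_neq0 (P : {poly F}) : P != 0 -> recenter P != 0.
Proof. by apply: contra_neq; apply: recenter_eq0. Qed.

Lemma gauss_index_monomial (r : {poly F}) i : r != 0 -> (size r < size Q)%N ->
  gauss_index le (recenter (r * Q ^+ i)) = (i * gauss_index le (recenter Q))%N.
Proof.
move=> r0 rQ; elim: i => [|i IH].
  by rewrite expr0 mulr1; case: (recenter_small r0 rQ).
rewrite exprSr mulrA rmorphM (gauss_index_mul N) ?IH ?mulSn ?[(_ + i * _)%N]addnC //.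
  by apply: recenter_neq0; rewrite mulf_neq0 ?expf_neq0.
exact: recenter_neq0.
Qed.

(** Divide by [Q] repeatedly.  The remainder has index [0] and a monomial with a
    positive power of [Q] has positive index, so they are never of the same size
    and one of them dominates. *)
Lemma lead_monomial (P : {poly F}) : P != 0 -> exists i (r : {poly F}),
  [/\ r != 0, (size r < size Q)%N & ~~ recenter_le (r * Q ^+ i) (P - r * Q ^+ i)].
Proof.
have NC := recenter_le_norm.
have [n] := ubnP (size P); elim: n P => // n IH P Pn P0.
have sQ : (1 < size Q)%N by rewrite -(size_map_poly psi) (root_size_gt1 _ Qb) ?lift_eq0.
have RQ : (size (P %% Q)%R < size Q)%N by rewrite ltn_modp.
have sP' : (size (P %/ Q)%R < n)%N.
  rewrite size_divp //; move: sQ Pn P0; rewrite -size_poly_gt0.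
  by move: (size _) (size _) => u v; lia.
have PE := divp_eq P Q; move: RQ sP' PE.
set R := (P %% Q)%R; set P' := (P %/ Q)%R => RQ sP' PE.
have [P'0|P'0] := eqVneq P' 0.
  have RP : P = R by rewrite PE P'0 mul0r add0r.
  exists 0%N, R; rewrite expr0 mulr1 -RP subrr (nlt0x NC); split=> //.
  by rewrite RP.
have [i [r [r0 rQ h]]] := IH P' sP' P'0.
have {}h : ~~ recenter_le (r * Q ^+ i.+1) (P' * Q - r * Q ^+ i.+1).
  by rewrite exprSr mulrA -mulrBl (nlt_pmul2r NC).
have [R0|R0] := eqVneq R 0.
  by exists i.+1, r; split=> //; rewrite PE R0 addr0.
have [WR|RW] := boolP (recenter_le (r * Q ^+ i.+1) R); last first.
  by exists i.+1, r; split=> //; rewrite PE addrAC (nltD NC).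
exists 0%N, R; rewrite expr0 mulr1; split=> //.
have {}WR : ~~ recenter_le R (r * Q ^+ i.+1).
  apply/negP => /(gauss_le_anti N WR); rewrite gauss_index_monomial //.
  case: (recenter_small R0 RQ) => -> _; have := gauss_index_recenter_gt0; lia.
rewrite PE addrK -(subrK (r * Q ^+ i.+1) (P' * Q)) (nltD NC) //.
exact: (nlt_trans NC) h WR.
Qed.

(** If [P] and [P2] have the same size, so do their leading monomials [r Q^i] and
    [s Q^l]; comparing indices gives [i = l], and then [r / s] is a unit of the
    given valuation ring, whose residue in [k] serves for [P / P2]. *)
Lemma recenter_le_residue (P P2 : {poly F}) : P2 != 0 -> recenter_le P P2 ->
  exists l, ~~ recenter_le P2 (P - (j l)%:P * P2).
Proof.
have NC := recenter_le_norm; move=> P20 PP2.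
have [P2P|nP2P] := boolP (recenter_le P2 P); last first.
  by exists 0; rewrite rmorph0 mul0r subr0.
have PeqP2 : nsame recenter_le P P2 by rewrite /nsame PP2 P2P.
have P0 : P != 0 by rewrite (nsame0 NC PeqP2).
have [i [r [r0 rQ hP]]] := lead_monomial P0.
have [l [s [s0 sQ hP2]]] := lead_monomial P20.
have eP := nsame_dist NC hP; have eP2 := nsame_dist NC hP2.
have ers : nsame recenter_le (r * Q ^+ i) (s * Q ^+ l).
  by rewrite nsame_sym in eP; apply: (nsame_trans NC eP) (nsame_trans NC PeqP2 eP2).
have il : i = l.
  case/andP: (ers) => h1 h2; have := gauss_le_anti N h1 h2.
  rewrite !gauss_index_monomial // => /eqP; rewrite eqn_pmul2r ?gauss_index_recenter_gt0 //.
  by move/eqP.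
rewrite -{}il in hP2 eP2 ers.
have Qi0 : Q ^+ i != 0 by rewrite expf_neq0.
have /andP[rs sr] : nsame recenter_le r s by move: ers; rewrite /nsame !(nle_pmul2r NC).
rewrite !recenter_le_small // in rs sr.
have evs : ev s != 0 by apply: contra_neq s0; apply: ev_inj.
have phis : phi (ev s) != 0 by rewrite fmorph_eq0.
have [m hm] : exists m, phi (ev r / ev s) - psi (j m) <| 1.
  apply: res; rewrite fmorph_div -(nle_pmul2r N _ _ phis) divfK // mul1r.
  exact: rs.
exists m.
have hrs : ~~ recenter_le s (r - (j m)%:P * s).
  have [->|h0] := eqVneq (r - (j m)%:P * s) 0; first by rewrite (nlt0x NC).
  rewrite recenter_le_small //; last first.
    rewrite (leq_ltn_trans (size_polyD _ _)) // size_polyN gtn_max rQ /=.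
    by rewrite mul_polyC (leq_ltn_trans (size_scale_leq _ _)).
  rewrite -(nlt_pmul2r N _ _ phis) mul1r mulrBl fmorph_div divfK // in hm.
  by rewrite rmorphB rmorphM rmorphB rmorphM /= /horner_eval map_polyC hornerC.
rewrite [P - _](_ : _ = (P - r * Q ^+ i) + (r - (j m)%:P * s) * Q ^+ i
   - (j m)%:P * (P2 - s * Q ^+ i)); last by ring.
have small x : ~~ recenter_le (s * Q ^+ i) x -> ~~ recenter_le P2 x.
  by rewrite (nsame_lel NC _ eP2).
apply: (nltB NC); first apply: (nltD NC); apply: small.
- by rewrite -(nsame_lel NC _ ers).
- by rewrite (nlt_pmul2r NC).
apply: (nle_lt_trans NC) hP2; rewrite -[X in recenter_le _ X]mul1r.
by apply: (nle_mul2r NC); apply: recenter_le_const.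
Qed.

Lemma recenter_place : place (f \o j) (frac_ring ev recenter_le).
Proof.
apply: (frac_place ev_inj ev_gen recenter_le_norm (iD := fun l => (j l)%:P)).
- by move=> l /=; rewrite /horner_eval map_polyC hornerC.
- exact: recenter_le_const.
- by move=> P P2; apply: recenter_le_residue.
Qed.

End Substitution.

Definition algF (a : L) : Prop := algebraicOver psi a.

Lemma algF_root n a z : algF a -> z ^+ n.+1 = a -> algF z.
Proof.
move=> [p p0 pa] zE; exists (p \Po 'X^(n.+1)); first by rewrite comp_poly_eq0 // size_polyXn.
by rewrite map_comp_poly map_polyXn rootE horner_comp hornerXn zE.
Qed.

Lemma nth_root_ex n (a : L) : exists z, z ^+ n.+1 = a.
Proof.
have [z zE] := @solve_monicpoly L n.+1 (fun i => if i == 0%N then a else 0) isT.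
exists z; rewrite zE big_ord_recl /= expr0 mulr1 big1 ?addr0 // => i _.
by rewrite mul0r.
Qed.

Lemma algF_between s t : algF s -> algF t -> s != 0 -> s <| t ->
  exists u, [/\ algF u, s <| u & u <| t].
Proof.
move=> hs ht s0 st; have [u uE] := nth_root_ex 1 (s * t); exists u.
have [su ut] := nlt_sqrt N s0 uE st; split=> //.
by apply: algF_root uE; apply: algebraic_mul.
Qed.

(** In an equation [p(g) = 0] two terms must have the same maximal size. *)
Lemma algF_torsion g : algF g -> g != 0 ->
  exists n e, e != 0 /\ g ^+ n.+1 ~| psi e.
Proof.
move=> [p p0 pg] g0.
pose P := \poly_(i < size p) (psi p`_i * g ^+ i).
have PE i : P`_i = psi p`_i * g ^+ i.
  by rewrite coef_poly; case: ltnP => // /(nth_default 0) ->; rewrite rmorph0 mul0r.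
have P0 : P != 0.
  apply/eqP => /(congr1 (fun q : {poly L} => q`_(size p).-1)); rewrite PE coef0.
  by apply/eqP; rewrite mulf_neq0 ?expf_neq0 // fmorph_eq0 lead_coef_eq0.
have [m1 m2] := gauss_indexP N P; have := gauss_index_neq0 N P0.
set i := gauss_index le P in m1 m2 * => Pi0.
have isz : (i < size p)%N.
  by rewrite ltnNge; apply: contra Pi0 => h; rewrite PE nth_default // rmorph0 mul0r.
have [l /andP[li Pl]] : exists l : 'I_(size p), (l != Ordinal isz) && (P`_i <=| P`_l).
  apply/existsP; rewrite -[X in is_true X]negbK negb_exists; apply/negP => /forallP h.
  have : P`_i + \sum_(l < size p | l != Ordinal isz) P`_l ~| P`_i.
    apply: (nsame_addr N); apply: (nlt_sum N) => // l li.
    by have := h l; rewrite li.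
  have : \sum_(l < size p) P`_l = 0.
    move: pg; rewrite rootE horner_coef size_map_poly => /eqP pg; rewrite -[RHS]pg.
    by apply: eq_bigr => l _; rewrite coef_map PE.
  rewrite (bigD1 (Ordinal isz)) //= => ->.
  by move=> /(nsame0 N); rewrite eqxx (negPf Pi0).
have il : (i < l)%N.
  rewrite ltn_neqAle eq_sym -[(_ == i)]/(l == Ordinal isz) li /=.
  by rewrite leqNgt; apply: contraL Pl => /m2.
have Pl0 : P`_l != 0 by apply: (nle_neq0 N) Pl _.
have pl0 : p`_l != 0.
  by apply: contra_neq Pl0 => h; rewrite PE h rmorph0 mul0r.
have pi0 : p`_i != 0.
  by apply: contra_neq Pi0 => h; rewrite PE h rmorph0 mul0r.
exists (l - i).-1, (p`_i / p`_l); split; first by rewrite mulf_neq0 ?invr_eq0.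
have psil : psi p`_l != 0 by rewrite fmorph_eq0.
have e : P`_l ~| P`_i by rewrite /nsame m1.
rewrite prednK ?subn_gt0 // fmorph_div -(nsame_pmul2r N _ _ psil) divfK //.
rewrite -(nsame_pmul2r N _ _ (expf_neq0 i g0)) -PE mulrAC -exprD subnK ?(ltnW il) //.
by rewrite mulrC -PE.
Qed.

Definition algP (P : {poly L}) := forall i, algF P`_i.

Lemma algF_sum (I : Type) (r : seq I) (Pr : pred I) (G : I -> L) :
  (forall i, algF (G i)) -> algF (\sum_(i <- r | Pr i) G i).
Proof.
move=> h; apply: (big_ind algF) => //; first exact: algebraic0.
by move=> x y; apply: algebraic_add.
Qed.

Lemma algP_mul P P' : algP P -> algP P' -> algP (P * P').
Proof.
by move=> h h' i; rewrite coefM; apply: algF_sum => u;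
  apply: algebraic_mul; [apply: h | apply: h'].
Qed.

Lemma algP_exp P n : algP P -> algP (P ^+ n).
Proof.
move=> h; elim: n => [|n IH]; last by rewrite exprS; apply: algP_mul.
by move=> i; rewrite expr0 coefC; case: eqP => _; [apply: algebraic1 | apply: algebraic0].
Qed.

Lemma algP_recenter b c Q : algF b -> algF c -> algP (recenter b c Q).
Proof.
move=> hb hc i; rewrite /recenter /= comp_polyE coef_sum; apply: algF_sum => l.
rewrite coefZ; apply: algebraic_mul; first by rewrite coef_map; apply: algebraic_id.
apply: algP_exp => u; rewrite coefD coefC coefZ coefX; apply: algebraic_add.
  by case: eqP => _ //; apply: algebraic0.
by case: eqP => _; rewrite ?mulr1 ?mulr0 //; apply: algebraic0.
Qed.

Lemma coef_recenter b c Q i : (recenter b c Q)`_i = (recenter b 1 Q)`_i * c ^+ i.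
Proof.
have -> : recenter b c Q = recenter b 1 Q \Po (c *: 'X).
  by rewrite /recenter /= -comp_polyA comp_polyD comp_polyC scale1r comp_polyX.
set P := recenter b 1 Q; rewrite comp_polyE coef_sum.
under eq_bigr => l _ do rewrite coefZ exprZn coefZ coefXn.
have [iP|Pi] := ltnP i (size P).
  rewrite (bigD1 (Ordinal iP)) //= eqxx mulr1 big1 ?addr0 // => l.
  by rewrite -val_eqE eq_sym /= => /negPf ->; rewrite !mulr0.
rewrite nth_default // mul0r big1 // => l _.
by rewrite gtn_eqF ?mulr0 // (leq_trans _ Pi).
Qed.

(** The Gauss norm of [Q(b + c Y)] strictly increases with [|c|], because its
    index is positive.  By density and torsion some power of [Q] is separated by
    an element [e] of [F] from its other Gauss norm: [Q^n / e] is integral for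
    [c1] and not for [c2]. *)
Lemma distinct_places b c1 c2 Q : Q != 0 -> root (lift Q) b ->
  c1 != 0 -> algF c1 -> algF c2 -> c1 <| c2 ->
  frac_ring ev (recenter_le b c1) <> frac_ring ev (recenter_le b c2).
Proof.
move=> Q0 Qb c10 h1 h2 c12; have c20 := nlt_neq0 N c12.
have hb : algF b by exists Q.
have GN := gauss_le_norm N.
set i := gauss_index le (recenter b c1 Q).
have i0 : (0 < i)%N by apply: gauss_index_recenter_gt0.
have q0 : (recenter b c1 Q)`_i != 0.
  by apply: gauss_index_neq0 => //; apply: contra_neq Q0; apply: recenter_eq0.
set g1 := (recenter b c1 Q)`_i in q0 *; set g2 := (recenter b c2 Q)`_i.
have g12 : g1 <| g2.
  move: q0; rewrite /g1 /g2 (coef_recenter b c1) (coef_recenter b c2) => q0.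
  apply: (nle_lt_mul N); rewrite ?nle_refl //.
    by apply: contra_neq q0 => ->; rewrite mul0r.
  by rewrite -(prednK i0); apply: nlt_pow.
have [g [hg gg1 gg2]] : exists u, [/\ algF u, g1 <| u & u <| g2].
  by apply: algF_between => //; apply: algP_recenter.
have g0 := nlt_neq0 N gg1.
have [n [e [e0 eE]]] := algF_torsion hg g0.
have eC0 : e%:P != 0 by rewrite polyC_eq0.
move=> E.
have substC b' c' : recenter b' c' e%:P = (psi e)%:P.
  by rewrite /recenter /= map_polyC comp_polyC.
have ge P : gauss_le le P ((g ^+ n.+1)%:P) = gauss_le le P (psi e)%:P.
  apply: (nsame_ler GN); rewrite /nsame; apply/andP.
  by rewrite !(gauss_leC N); case/andP: eE.
have B1 : frac_ring ev (recenter_le b c1) (ev (Q ^+ n.+1) / ev e%:P).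
  apply/(frac_ringE ev_inj (recenter_le_norm b c10) _ eC0).
  rewrite /recenter_le substC rmorphXn -ge polyC_exp; apply: (nltW GN).
  by apply: (nlt_pow GN); apply: (gauss_leC_lt N).
rewrite E in B1; move/(frac_ringE ev_inj (recenter_le_norm b c20) _ eC0): B1.
rewrite /recenter_le substC rmorphXn -ge polyC_exp; apply/negP.
by apply: (nlt_pow GN); apply: (gauss_leC_gt N) gg2.
Qed.

Hypothesis algK : forall z : L, algebraicOver phi z.

(** Scale an equation of [z] over [K] to have Gauss norm one and replace its
    coefficients by their residues in [k].  The new polynomial is small at [z],
    so one of its roots is close to [z]. *)
Lemma residue_algebraic z : z <=| 1 -> exists e, algF e /\ z - e <| 1.
Proof.
move=> z1; have [p p0 /eqP pz] := algK z.
have lp0 : map_poly phi p != 0 by rewrite map_poly_eq0.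
have [m1 _] := gauss_indexP N (map_poly phi p); have := gauss_index_neq0 N lp0.
set i := gauss_index le _ in m1 *; rewrite coef_map => pi0.
have /choice[lam hlam] : forall l, exists m, phi (p`_l / p`_i) - psi (j m) <| 1.
  move=> l; apply: res; rewrite fmorph_div -(nle_pmul2r N _ _ pi0) divfK // mul1r.
  by rewrite -!coef_map.
have pi0' : p`_i != 0 by rewrite -(fmorph_eq0 phi).
have isz : (i < size p)%N.
  by rewrite ltnNge; apply: contra pi0' => h; rewrite nth_default.
pose P : {poly F} := \poly_(l < size p) j (lam l).
have unit m : j m != 0 -> 1 <=| psi (j m).
  move=> m0; have pm0 : psi (j m) != 0 by rewrite fmorph_eq0.
  have := triv m^-1; rewrite -(nle_pmul2r N _ _ pm0) mul1r !fmorphV mulVf //.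
have P0 : P != 0.
  apply/eqP => /(congr1 (fun q : {poly F} => q`_i)); rewrite coef_poly isz coef0.
  move=> h; have := hlam i; rewrite h rmorph0 subr0 divff // rmorph1.
  by rewrite (nle_refl N).
have Pz : (lift P).[z] <| 1.
  have sP : (size (lift P) <= size p)%N by rewrite size_map_poly size_poly.
  rewrite (horner_coef_wide _ sP).
  have -> : \sum_(l < size p) (lift P)`_l * z ^+ l =
      - \sum_(l < size p) (phi (p`_l / p`_i) - psi (j (lam l))) * z ^+ l.
    under [in RHS]eq_bigr => l _ do rewrite mulrBl.
    rewrite sumrB opprB.
    have -> : \sum_(l < size p) phi (p`_l / p`_i) * z ^+ l = 0.
      under eq_bigr => l _ do rewrite fmorph_div mulrAC -coef_map.
      by rewrite -mulr_suml -(size_map_poly phi p) -horner_coef pz mul0r.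
    rewrite subr0; apply: eq_bigr => l _.
    by rewrite coef_map coef_poly ltn_ord.
  rewrite (nleNr N); apply: (nlt_sum N); rewrite ?oner_eq0 // => l _.
  rewrite -[X in _ <| X]mulr1; apply: (nlt_le_mul N); rewrite ?oner_eq0 ?hlam //.
  by rewrite -(expr1n _ l) nle_pow.
have [|no] := pselect (exists e, algF e /\ z - e <| 1) => //.
have lP0 : lift P != 0 by rewrite lift_eq0.
have E := rootsLE (lift P); have rsE a := @mem_rootsL _ (lift P) a lP0.
move: (rootsL _) E rsE => rs E rsE.
case/negP: Pz; rewrite E hornerZ.
rewrite -[X in X <=| _]mulr1; apply: (nle_mul N).
  have lc : lead_coef (lift P) = psi (lead_coef P) by rewrite lead_coef_map.
  rewrite lc lead_coefE coef_poly.
  have := P0; rewrite -lead_coef_eq0 lead_coefE coef_poly.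
  by case: ifP => [_ /unit //|_]; rewrite eqxx.
have : forall a, a \in rs -> 1 <=| z - a.
  move=> a; rewrite rsE => Pa; apply/negPn/negP => h; apply: no; exists a.
  by split=> //; exists P.
elim: rs {E rsE} => [_|a rs IH h]; first by rewrite big_nil hornerC nle_refl.
rewrite big_cons hornerM !hornerE -[X in X <=| _]mulr1; apply: (nle_mul N).
  by apply: h; rewrite mem_head.
by apply: IH => a' ars; apply: h; rewrite inE ars orbT.
Qed.

Variable y : F.
Hypotheses (y0 : y != 0) (y1 : psi y <| 1).

Lemma algF_psi a : algF (psi a).
Proof. exact: algebraic_id. Qed.

Lemma psiy0 : psi y != 0. Proof. by rewrite fmorph_eq0. Qed.

(** Density of the values of [Fbar], in a form that keeps clear of a finite set:
    there is a value just below [|t|]. *)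
Lemma algF_down t (S : seq L) : algF t -> t != 0 -> (forall s, s \in S -> algF s) ->
  exists t', [/\ algF t', t' != 0, t' <| t &
    forall s, s \in S -> s <| t -> s <| t'].
Proof.
move=> ht t0; elim: S => [_|s S IH hS].
  exists (t * psi y); split=> //.
  - by apply: algebraic_mul => //; apply: algF_psi.
  - by rewrite mulf_neq0 ?psiy0.
  - by rewrite -[X in _ <| X]mulr1 (nle_lt_mul N) ?nle_refl.
have [t' [h1 h2 h3 h4]] : exists t', [/\ algF t', t' != 0, t' <| t &
    forall s, s \in S -> s <| t -> s <| t'].
  by apply: IH => s' s'S; apply: hS; rewrite inE s'S orbT.
have [t's|st'] := boolP (t' <=| s); last first.
  by exists t'; split=> // s'; rewrite inE => /orP[/eqP ->//|]; apply: h4.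
have [ts|st] := boolP (t <=| s).
  exists t'; split=> // s'; rewrite inE => /orP[/eqP ->|]; last exact: h4.
  by rewrite ts.
have hs : algF s by apply: hS; rewrite mem_head.
have [u [hu su ut]] := algF_between hs ht (nle_neq0 N t's h2) st.
exists u; split=> //; first exact: (nlt_neq0 N) su.
move=> s'; rewrite inE => /orP[/eqP -> //|s'S s't].
by apply: (nlt_trans N) su; apply: (nlt_le_trans N) t's; apply: h4.
Qed.

Lemma algF_up t (S : seq L) : algF t -> t != 0 -> (forall s, s \in S -> algF s) ->
  exists t', [/\ algF t', t <| t' &
    forall s, s \in S -> t <| s -> t' <| s].
Proof.
move=> ht t0; elim: S => [_|s S IH hS].
  exists (t / psi y); split=> //.
  - by apply: algebraic_mul => //; apply: algebraic_inv; apply: algF_psi.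
  - rewrite -(nlt_pmul2r N _ _ psiy0) divfK ?psiy0 // -[X in _ <| X]mulr1.
    by rewrite (nle_lt_mul N) ?nle_refl.
have [t' [h1 h2 h3]] : exists t', [/\ algF t', t <| t' &
    forall s, s \in S -> t <| s -> t' <| s].
  by apply: IH => s' s'S; apply: hS; rewrite inE s'S orbT.
have [st'|t's] := boolP (s <=| t'); last first.
  by exists t'; split=> // s'; rewrite inE => /orP[/eqP ->//|]; apply: h3.
have [st|ts] := boolP (s <=| t).
  exists t'; split=> // s'; rewrite inE => /orP[/eqP ->|]; last exact: h3.
  by rewrite st.
have hs : algF s by apply: hS; rewrite mem_head.
have [u [hu tu us]] := algF_between ht hs t0 ts.
exists u; split=> // s'; rewrite inE => /orP[/eqP -> //|s'S s't].
by apply: (nlt_trans N) us _; apply: (nle_lt_trans N) st' _; apply: h3.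
Qed.

Definition same_side (g c s : L) := (s <| g) && (s <| c) || (g <| s) && (c <| s).

(** A size [|g|] that is no value of [Fbar] can be approximated by a value that
    lies on the same side of finitely many others.  Whenever [t] is on the wrong
    side of [s], it is replaced by a value next to [|s|]. *)
Lemma algF_sample g (S : seq L) : (forall s, algF s -> ~~ (g ~| s)) ->
  (forall s, s \in S -> algF s) ->
  exists t, [/\ algF t, t != 0 & forall s, s \in S -> same_side g t s].
Proof.
move=> hg; elim: S => [_|s S IH hS].
  by exists 1; split; rewrite ?oner_eq0 //; apply: algebraic1.
have hS' s' : s' \in S -> algF s' by move=> s'S; apply: hS; rewrite inE s'S orbT.
have [t [ht t0 tS]] := IH hS'.
have hs : algF s by apply: hS; rewrite mem_head.
have main u : algF u -> u != 0 -> same_side g u s ->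
    (forall s', s' \in S -> same_side g u s') ->
    exists t, [/\ algF t, t != 0 & forall s', s' \in s :: S -> same_side g t s'].
  by move=> *; exists u; split=> // s'; rewrite inE => /orP[/eqP ->|]; auto.
have := hg s hs; rewrite negb_and => /orP[sg|gs].
  have [ts|st] := boolP (t <=| s); last first.
    by apply: (main t) => //; rewrite /same_side sg st.
  have s0 := nle_neq0 N ts t0.
  have [u [hu su uS]] := algF_up hs s0 hS'.
  apply: (main u) => //; first exact: (nlt_neq0 N) su.
    by rewrite /same_side sg su.
  move=> s' s'S; rewrite /same_side.
  case/orP: (tS s' s'S) => /andP[h1 h2]; rewrite h1 /=.
    by rewrite (nlt_trans N (nlt_le_trans N h2 ts) su).
  by rewrite uS ?orbT //; apply: (nlt_trans N) h1.
have [st|ts] := boolP (s <=| t); last first.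
  by apply: (main t) => //; rewrite /same_side gs ts orbT.
have [s0|s0] := eqVneq s 0; first by rewrite s0 (nle0x N) in gs.
have [u [hu u0 us uS]] := algF_down hs s0 hS'.
apply: (main u) => //; first by rewrite /same_side gs us orbT.
move=> s' s'S; rewrite /same_side.
case/orP: (tS s' s'S) => /andP[h1 h2]; rewrite h1 /=.
  by rewrite uS //; apply: (nlt_trans N) h1 gs.
by rewrite (nlt_trans N us (nle_lt_trans N st h2)) orbT.
Qed.

(** For [m = m'] the comparison does not depend on [g].  Otherwise it compares a
    power of [|g|] with a value of [Fbar], that is, [|g|] with a root [s] of that
    value.  The right-hand side is the refined comparison of Gauss norms, where
    ties are excluded as [|c|] differs from [|s|]. *)
Lemma threshold g e m e' m' : g != 0 -> e != 0 -> e' != 0 -> algF e -> algF e' ->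
  exists s, algF s /\ forall c, c != 0 -> same_side g c s ->
  (e * g ^+ m <=| e' * g ^+ m') =
  (e * c ^+ m <| e' * c ^+ m') || (e * c ^+ m <=| e' * c ^+ m') && (m' <= m)%N.
Proof.
move=> g0 e0 e'0 he he'.
have root_of a b n : algF a -> algF b -> exists s, algF s /\ s ^+ n.+1 = a / b.
  move=> ha hb; have [s sE] := nth_root_ex n (a / b); exists s; split=> //.
  by apply: algF_root sE; apply: algebraic_div.
case: (ltngtP m m') => [mm'|m'm|->].
- have [s [hs sE]] := root_of e e' (m' - m).-1 he he'; exists s; split=> // c c0 sgc.
  rewrite andbF orbF.
  have cmp x : x != 0 -> ((e * x ^+ m <=| e' * x ^+ m') = (s <=| x)) *
      ((e' * x ^+ m' <=| e * x ^+ m) = (x <=| s)).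
    move=> x0; have -> : e' * x ^+ m' = e' * x ^+ (m' - m).-1.+1 * x ^+ m.
      by rewrite prednK ?subn_gt0 // -mulrA -exprD subnK // ltnW.
    rewrite !(nle_pmul2r N) ?expf_neq0 //.
    rewrite -(nle_powE N (m' - m).-1 s) -(nle_powE N (m' - m).-1 x) sE.
    by rewrite -(nle_pmul2r N (e / e') _ e'0) -(nle_pmul2r N _ (e / e') e'0)
      divfK // ![e' * _]mulrC.
  rewrite (cmp g) // (cmp c) //.
  case/orP: sgc => /andP[h1 h2]; first by rewrite h2 (nltW N h1).
  by rewrite (nltW N h2) (negPf h1).
- have [s [hs sE]] := root_of e' e (m - m').-1 he' he; exists s; split=> // c c0 sgc.
  rewrite andbT.
  have cmp x : x != 0 -> ((e * x ^+ m <=| e' * x ^+ m') = (x <=| s)) *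
      ((e' * x ^+ m' <=| e * x ^+ m) = (s <=| x)).
    move=> x0; have -> : e * x ^+ m = e * x ^+ (m - m').-1.+1 * x ^+ m'.
      by rewrite prednK ?subn_gt0 // -mulrA -exprD subnK // ltnW.
    rewrite !(nle_pmul2r N) ?expf_neq0 //.
    rewrite -(nle_powE N (m - m').-1 s) -(nle_powE N (m - m').-1 x) sE.
    by rewrite -(nle_pmul2r N (e' / e) _ e0) -(nle_pmul2r N _ (e' / e) e0)
      divfK // ![e * _]mulrC.
  rewrite (cmp g) // !(cmp c) //.
  case/orP: sgc => /andP[h1 h2]; last by rewrite h2 (nltW N h1).
  by rewrite (negPf h1) (negPf h2) (nltW N h2).
exists 1; split=> [|c c0 _]; first exact: algebraic1.
by rewrite ?leqnn andbT !(nle_pmul2r N) ?expf_neq0 // orb_idl // => /(nltW N).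
Qed.

Lemma rootsL_alg P a : P != 0 -> a \in rootsL (lift P) -> algF a.
Proof. by move=> P0; rewrite mem_rootsL ?lift_eq0 // => Pa; exists P. Qed.

(** [Q] has minimal degree among all polynomials with a root that satisfies [Pr],
    so that the roots of polynomials of smaller degree all violate [Pr]. *)
Lemma minimal_choice (Pr : L -> Prop) : (exists b, algF b /\ Pr b) ->
  exists b Q, [/\ Q != 0, root (lift Q) b, Pr b &
    forall (g : {poly F}) a, g != 0 -> (size g < size Q)%N ->
      root (lift g) a -> ~ Pr a].
Proof.
move=> [b [[Q Q0 Qb] Prb]].
have ex : exists n, `[< exists (b' : L) (Q' : {poly F}),
    [/\ Q' != 0, root (lift Q') b', Pr b' & size Q' = n] >].
  by exists (size Q); apply/asboolP; exists b, Q.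
case: (ex_minnP ex) => n /asboolP[b' [Q' [Q'0 Qb' Prb' sQ']]] mn.
exists b', Q'; split=> // g a g0 gQ ga Pra; move: gQ; rewrite ltnNge sQ' mn //.
by apply/asboolP; exists a, g.
Qed.

Section Shape.
Variables (a0 : L).
Let g := xi - a0.
Definition moving (a : L) : bool := xi - a ~| g.

(** In the situation below, [|X - a| = |a0 - a|] for the other roots [a], so that
    this factor, which lies in [Fbar], accounts for all of [|p(X)|] except for a
    power of [|g|]. *)
Definition fixed_factor (p : {poly L}) : L :=
  lead_coef p * \prod_(a <- rootsL p | ~~ moving a) (a0 - a).
Definition moving_count (p : {poly L}) : nat := count moving (rootsL p).

Lemma shape_value (p : {poly L}) :
  (forall a, a \in rootsL p -> ~~ moving a -> xi - a ~| a0 - a) ->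
  p.[xi] ~| fixed_factor p * g ^+ moving_count p.
Proof.
move=> h; rewrite {1}(rootsLE p) hornerZ -mulrA; apply: (nsame_mul N (nsame_refl N _)).
rewrite /moving_count; elim: (rootsL p) h => [_|a rs IH h].
  by rewrite !big_nil hornerC mulr1 nsame_refl.
have {}IH := IH (fun a' ars => h a' (mem_behead (ars : a' \in behead (a :: rs)))).
rewrite !big_cons hornerM !hornerE /=; case: (boolP (moving a)) => ma /=.
  by rewrite exprS mulrCA; apply: nsame_mul.
by rewrite add0n -mulrA; apply: nsame_mul => //; apply: h; rewrite ?mem_head.
Qed.

(** After the substitution the moving factors [X - a] acquire index one and size
    [|c|], whereas the other factors keep their sizes. *)
Lemma shape_recenter b c (p : {poly L}) : p != 0 -> c != 0 ->
  (forall a, a \in rootsL p -> if moving a then b - a <| c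
     else (b - a ~| a0 - a) && (c <| b - a)) ->
  let q := p \Po (b%:P + c *: 'X) in
  gauss_index le q = moving_count p /\
  q`_(gauss_index le q) ~| fixed_factor p * c ^+ moving_count p.
Proof.
move=> p0 c0 h /=; rewrite {1 3 4}(rootsLE p) comp_polyZ rmorph_prod /= /fixed_factor -mulrA.
have lc0 : lead_coef p != 0 by rewrite lead_coef_eq0.
have lin0 a : (b - a)%:P + c *: 'X != 0.
  apply: contra_neq c0 => /(congr1 (fun q : {poly L} => q`_1)).
  by rewrite coefD coefC coefZ coefX coef0 /= add0r mulr1.
suff: let q := \prod_(z <- rootsL p) (('X - z%:P) \Po (b%:P + c *: 'X)) in
    [/\ q != 0, gauss_index le q = moving_count p &
     q`_(gauss_index le q) ~| \prod_(a <- rootsL p | ~~ moving a) (a0 - a) * c ^+ moving_count p].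
  move=> /= [q0 gq qE]; rewrite -mul_polyC; split.
    by rewrite (gauss_index_mul N) ?polyC_eq0 // (gauss_indexC N).
  apply: (nsame_trans N) (gauss_coef_mul N _ q0) _; first by rewrite polyC_eq0.
  by rewrite (gauss_indexC N) coefC; apply: (nsame_mul N (nsame_refl N _)).
rewrite /moving_count; elim: (rootsL p) h => [_|a rs IH h].
  by rewrite !big_nil (gauss_indexC N) coefC mulr1 nsame_refl // polyC_eq0 oner_eq0.
have [q0 gq qE] := IH (fun a' ars => h a' (mem_behead (ars : a' \in behead (a :: rs)))).
rewrite !big_cons linear_comp; split.
- exact: mulf_neq0.
- rewrite (gauss_index_mul N) //= gq; congr addn.
  have := h a (mem_head _ _); case: (boolP (moving a)) => _ => [bac|/andP[_ cba]].
    apply: (gauss_indexE N); split=> -[|[|i]] //=; rewrite !coefD !coefC !coefZ !coefX /=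
      ?(mulr0, mulr1, addr0, add0r) ?(nle0x N) ?nle_refl //.
    exact: (nltW N).
  by apply: (dominant0_index N); apply: (dominant0_linear N).
- apply: (nsame_trans N) (gauss_coef_mul N (lin0 a) q0) _ => /=.
  have := h a (mem_head _ _); case: (boolP (moving a)) => _ /= => [bac|/andP[ba cba]].
    have -> : gauss_index le ((b - a)%:P + c *: 'X) = 1%N.
      apply: (gauss_indexE N); split=> -[|[|i]] //=; rewrite !coefD !coefC !coefZ !coefX /=
        ?(mulr0, mulr1, addr0, add0r) ?(nle0x N) ?nle_refl //.
      exact: (nltW N).
    rewrite coefD coefC coefZ coefX /= add0r mulr1 exprS mulrCA.
    by apply: (nsame_mul N (nsame_refl N _)).
  rewrite (dominant0_index N (dominant0_linear N cba)) coefD coefC coefZ coefX /=.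
  by rewrite mulr0 addr0 add0n -mulrA; apply: nsame_mul.
Qed.

End Shape.

Definition agrees b c (ps : seq {poly F}) := forall P P', P \in ps -> P' \in ps ->
  recenter_le b c P P' = (phi (ev P) <=| phi (ev P')).

(** Two different places in the neighbourhood of the given one that is cut out by
    all quotients of elements of [ps].  Having two of them avoids the comparison
    of the perturbed places with the given one. *)
Definition two_places (ps : seq {poly F}) := exists A1 A2 : set K,
  [/\ place (f \o j) A1, place (f \o j) A2, A1 <> A2 &
    forall P P', P \in ps -> P' \in ps -> P' != 0 ->
      (A1 (ev P / ev P') <-> phi (ev P) <=| phi (ev P')) /\
      (A2 (ev P / ev P') <-> phi (ev P) <=| phi (ev P'))].

Lemma agrees_neq0 b c ps : c != 0 ->
  (forall P P', P != 0 -> P' != 0 -> P \in ps -> P' \in ps ->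
    recenter_le b c P P' = (phi (ev P) <=| phi (ev P'))) -> agrees b c ps.
Proof.
move=> c0 h P P' Pps P'ps; have NC := recenter_le_norm b c0.
have [->|P0] := eqVneq P 0; first by rewrite !rmorph0 (nle0x NC) (nle0x N).
have [->|P'0] := eqVneq P' 0; last exact: h.
rewrite !rmorph0; apply/idP/idP => [/(nle0 NC)/eqP|/(nle0 N)/eqP].
  by rewrite (negPf P0).
by rewrite !fmorph_eq0 (ev_eq0 ev_inj) (negPf P0).
Qed.

Lemma two_places_of ps b c1 c2 (Q : {poly F}) : Q != 0 -> root (lift Q) b ->
  c1 != 0 -> algF c1 -> algF c2 -> c1 <| c2 ->
  (forall (g : {poly F}) a, g != 0 -> (size g < size Q)%N -> root (lift g) a ->
     (xi - b <| b - a) && (c2 <| b - a)) ->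
  agrees b c1 ps -> agrees b c2 ps -> two_places ps.
Proof.
move=> Q0 Qb c10 h1 h2 c12 Qmin a1 a2; have c20 := nlt_neq0 N c12.
have Qmin1 (g : {poly F}) a : g != 0 -> (size g < size Q)%N -> root (lift g) a ->
    (xi - b <| b - a) && (c1 <| b - a).
  move=> g0 gQ ga; have /andP[-> h] := Qmin g a g0 gQ ga.
  exact: (nlt_trans N) c12 h.
exists (frac_ring ev (recenter_le b c1)), (frac_ring ev (recenter_le b c2)); split.
- exact: (recenter_place c10 Q0 Qb Qmin1).
- exact: (recenter_place c20 Q0 Qb Qmin).
- exact: (distinct_places Q0 Qb).
- move=> P P' Pps P'ps P'0.
  rewrite (frac_ringE ev_inj (recenter_le_norm b c10)) //.
  rewrite (frac_ringE ev_inj (recenter_le_norm b c20)) //.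
  by rewrite a1 // a2.
Qed.

(** Otherwise [X] would be algebraic over [F]. *)
Lemma xi_transc a : algF a -> xi - a != 0.
Proof.
move=> [p p0 pa]; apply: contra_neq p0; move/eqP; rewrite subr_eq0 => /eqP xa.
apply: ev_inj; apply/eqP; rewrite -(fmorph_eq0 phi) phi_ev xa; exact: pa.
Qed.

(** Since residues of [L] are represented by [Fbar], no [a] in [Fbar] is closest
    to [X]: if [|X - a| = |beta|], then [a + e beta] is closer, where [e] has the
    residue of [(X - a) / beta].  Hence one can recenter at a point [b] closer to
    [X] than all the roots that occur, and choose [|c|] between [|X - b|] and
    these distances: no linear factor changes its size. *)
Lemma two_places_immediate ps :
  (forall a, algF a -> exists s, algF s /\ xi - a ~| s) -> two_places ps.
Proof.
move=> himm.
pose rs := 0 :: flatten [seq rootsL (lift P) | P <- ps & P != 0].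
have rs_alg a : a \in rs -> algF a.
  rewrite inE => /orP[/eqP ->|/flattenP[r /mapP[P]]]; first exact: algebraic0.
  rewrite mem_filter => /andP[P0 _] ->; exact: rootsL_alg.
have [a [ars amin]] : exists a, a \in rs /\ forall a', a' \in rs -> xi - a <=| xi - a'.
  rewrite /rs; elim: (flatten _) (0 : L) => [|a' r IH] a.
    exists a; rewrite mem_head; split=> // a'; rewrite inE => /eqP ->.
    exact: nle_refl.
  have [b [br bmin]] := IH a'.
  case/orP: (nle_total N (xi - a) (xi - b)) => h.
    exists a; rewrite mem_head; split=> // c; rewrite inE => /orP[/eqP ->|/bmin].
      exact: nle_refl.
    exact: (nle_trans N).
  exists b; rewrite inE br orbT; split=> // c; rewrite inE => /orP[/eqP -> //|].
  exact: bmin.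
have aa := rs_alg a ars; have [beta [hbeta abeta]] := himm a aa.
have beta0 : beta != 0 by rewrite -(nsame0 N abeta) xi_transc.
have [b' [hb' b'beta]] : exists b', algF b' /\ xi - b' <| beta.
  have [e [he ze]] : exists e, algF e /\ (xi - a) / beta - e <| 1.
    apply: residue_algebraic; rewrite -(nle_pmul2r N _ _ beta0) divfK // mul1r.
    by case/andP: abeta.
  exists (a + e * beta); split.
    by apply: algebraic_add => //; apply: algebraic_mul.
  rewrite opprD addrA -[X in _ <| X]mul1r -{1}[xi - a](divfK beta0) -mulrBl.
  by rewrite (nlt_pmul2r N).
have [|b [Q [Q0 Qb bbeta bmin]]] := @minimal_choice (fun b => xi - b <| beta).
  by exists b'.
have hb : algF b by exists Q.
have [s [hs bs]] := himm b hb.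
have s0 : s != 0 by rewrite -(nsame0 N bs) xi_transc.
have sbeta : s <| beta by rewrite -(nsame_ler N _ bs).
have [c1 [hc1 sc1 c1b]] := algF_between hs hbeta s0 sbeta.
have c10 := nlt_neq0 N sc1.
have [c2 [hc2 c12 c2b]] := algF_between hc1 hbeta c10 c1b.
have afar a' : beta <=| xi - a' -> beta <=| b - a'.
  move=> h; have e : b - a' ~| xi - a'.
    apply: (nsame_dist N); rewrite (_ : b - a' - (xi - a') = b - xi); last by ring.
    by rewrite (nlt_distC N); apply: (nlt_le_trans N) h.
  by rewrite (nsame_ler N _ e).
have agr c : c != 0 -> c <| beta -> agrees b c ps.
  move=> c0 cb; apply: agrees_neq0 => // P P' P0 P'0 Pps P'ps.
  have Pfar (P1 : {poly F}) : P1 != 0 -> P1 \in ps -> far b c P1.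
    move=> P10 P1ps a' ra'; have h : beta <=| b - a'.
      apply: afar; rewrite -(nsame_lel N _ abeta); apply: amin.
      rewrite inE; apply/orP; right; apply/flattenP; exists (rootsL (lift P1)).
        by apply/mapP; exists P1 => //; rewrite mem_filter P10.
      by rewrite mem_rootsL // lift_eq0.
    by rewrite (nlt_le_trans N bbeta h) (nlt_le_trans N cb h).
  by apply: recenter_le_far => //; apply: Pfar.
apply: (two_places_of Q0 Qb c10 hc1 hc2 c12).
- move=> g a' g0 gQ ga; have /negP/negPn/afar h := bmin g a' g0 gQ ga.
  by rewrite (nlt_le_trans N bbeta h) (nlt_le_trans N c2b h).
- exact: agr.
- by apply: agr => //; apply: nlt_neq0 c12.
Qed.

(** Let [t] be a value of [Fbar] on the same side as [|g|] of all the thresholds.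
    If [|t| < |g|], one recenters at [a0] itself, and [|c|] is [|t|] or a smaller
    value.  If [|g| < |t|], roots of small degree might lie at distances between
    [|g|] and [|t|], which would spoil the minimality of [a0]; one therefore
    takes a value [beta] just above [t], recenters at a [b] of minimal degree
    with [|X - b| < |beta|], and chooses [|c|] above [|t|] and [|X - b|] but below
    [|beta|]. *)
Lemma two_places_transcendental ps :
  (exists a, algF a /\ forall s, algF s -> ~~ (xi - a ~| s)) -> two_places ps.
Proof.
move=> /minimal_choice[a0 [Q0 [Q00 Q0a hg Q0min]]].
have ha0 : algF a0 by exists Q0.
have g0 := xi_transc ha0; set g := xi - a0 in hg g0.
pose rs := flatten [seq rootsL (lift P) | P <- ps & P != 0].
have rsP (P : {poly F}) a : P != 0 -> P \in ps -> a \in rootsL (lift P) -> a \in rs.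
  move=> P0 Pps aP; apply/flattenP; exists (rootsL (lift P)) => //.
  by apply/mapP; exists P => //; rewrite mem_filter P0.
have rs_alg a : a \in rs -> algF a.
  move=> /flattenP[r /mapP[P]].
  rewrite mem_filter => /andP[P0 _] ->; exact: rootsL_alg.
(* As [|g|] is no value of [Fbar], [X - a = g + (a0 - a)] has the size of the
   larger summand. *)
have dist a : algF a ->
    [/\ a0 - a <| g & moving a0 a] \/ [/\ g <| a0 - a, ~~ moving a0 a & xi - a ~| a0 - a].
  move=> ha; have haa : algF (a0 - a) by apply: algebraic_sub.
  have xE : xi - a = g + (a0 - a) by rewrite /g; ring.
  have := hg _ haa; rewrite negb_and => /orP[h|h].
    by left; split=> //; rewrite /moving xE (nsame_addr N).
  have e : xi - a ~| a0 - a by rewrite xE (nsame_addl N).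
  right; split=> //; apply/negP => m; have := hg _ haa.
  by rewrite (@nsame_trans _ _ N (xi - a)) // nsame_sym.
have ealg (P : {poly F}) : P != 0 -> P \in ps ->
    algF (fixed_factor a0 (lift P)) /\ fixed_factor a0 (lift P) != 0.
  move=> P0 Pps; rewrite /fixed_factor.
  have : forall a, a \in rootsL (lift P) -> algF a.
    by move=> a /(rsP _ _ P0 Pps)/rs_alg.
  have lc : algF (lead_coef (lift P)) /\ lead_coef (lift P) != 0.
    by rewrite lead_coef_map fmorph_eq0 lead_coef_eq0; split=> //; apply: algF_psi.
  elim: (rootsL _) => [|a r IH] hr; first by rewrite big_nil mulr1.
  have {}IH := IH (fun a' ars => hr a' (mem_behead (ars : a' \in behead (a :: r)))).
  rewrite big_cons; case: (boolP (moving a0 a)) => //= na.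
  rewrite mulrCA; case: IH => IH1 IH2; have ha := hr a (mem_head _ _).
  split; first by apply: algebraic_mul => //; apply: algebraic_sub.
  rewrite mulf_neq0 //; case: (dist a ha) => -[h1 h2]; first by rewrite h2 in na.
  by move=> _; apply: (nlt_neq0 N) h1.
have /choice[th thP] : forall pr : {poly F} * {poly F}, exists s, algF s /\
    (pr.1 != 0 -> pr.2 != 0 -> pr.1 \in ps -> pr.2 \in ps ->
     forall c, c != 0 -> same_side g c s ->
     (phi (ev pr.1) <=| phi (ev pr.2)) =
     (fixed_factor a0 (lift pr.1) * c ^+ moving_count a0 (lift pr.1) <|
      fixed_factor a0 (lift pr.2) * c ^+ moving_count a0 (lift pr.2)) ||
     (fixed_factor a0 (lift pr.1) * c ^+ moving_count a0 (lift pr.1) <=|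
      fixed_factor a0 (lift pr.2) * c ^+ moving_count a0 (lift pr.2)) &&
     (moving_count a0 (lift pr.2) <= moving_count a0 (lift pr.1))%N).
  move=> [P P'] /=.
  have [/and4P[P0 P'0 Pps P'ps]|no] :=
      boolP [&& P != 0, P' != 0, P \in ps & P' \in ps]; last first.
    exists 1; split; first exact: algebraic1.
    by move=> h1 h2 h3 h4; rewrite h1 h2 h3 h4 in no.
  have [he e0] := ealg P P0 Pps; have [he' e'0] := ealg P' P'0 P'ps.
  have [s [hs sP]] := threshold (moving_count a0 (lift P))
    (moving_count a0 (lift P')) g0 e0 e'0 he he'.
  exists s; split=> // _ _ _ _ c c0 sgc; rewrite -sP //.
  have val (P1 : {poly F}) : P1 != 0 -> P1 \in ps -> phi (ev P1) ~|
      fixed_factor a0 (lift P1) * g ^+ moving_count a0 (lift P1).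
    move=> P10 P1ps; rewrite phi_ev; apply: shape_value => a.
    move=> /(rsP _ _ P10 P1ps)/rs_alg ha na.
    by case: (dist a ha) => -[h1 h2 //]; rewrite h2 in na.
  by rewrite (nsame_lel N _ (val P P0 Pps)) (nsame_ler N _ (val P' P'0 P'ps)).
(* The distances from [a0] to the roots are thresholds as well: this keeps the
   moving roots within [|c|] and the other ones beyond it. *)
pose S := [seq th (P, P') | P <- ps, P' <- ps] ++ [seq a0 - a | a <- rs].
have S_alg s : s \in S -> algF s.
  rewrite mem_cat => /orP[/allpairsP[[P P'] [_ _ ->]]|/mapP[a /rs_alg ha ->]].
    by case: (thP (P, P')).
  exact: algebraic_sub.
have agr b c : c != 0 -> (forall s, s \in S -> same_side g c s) ->
    (forall a, a \in rs -> if moving a0 a then b - a <| c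
      else (b - a ~| a0 - a) && (c <| b - a)) -> agrees b c ps.
  move=> c0 cS cr; apply: agrees_neq0 => // P P' P0 P'0 Pps P'ps.
  have [_ /(_ P0 P'0 Pps P'ps c c0)] := thP (P, P'); rewrite /= => -> //; last first.
    apply: cS; rewrite mem_cat; apply/orP; left; apply/allpairsP.
    by exists (P, P').
  have shp (P1 : {poly F}) : P1 != 0 -> P1 \in ps ->
      gauss_index le (recenter b c P1) = moving_count a0 (lift P1) /\
      (recenter b c P1)`_(gauss_index le (recenter b c P1)) ~|
        fixed_factor a0 (lift P1) * c ^+ moving_count a0 (lift P1).
    move=> P10 P1ps; apply: shape_recenter => //; first by rewrite lift_eq0.
    by move=> a /(rsP _ _ P10 P1ps)/cr.
  have [gP cP] := shp P P0 Pps; have [gP' cP'] := shp P' P'0 P'ps.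
  rewrite /recenter_le /gauss_le (nsame_lel N _ cP) (nsame_ler N _ cP')
    (nsame_lel N _ cP') (nsame_ler N _ cP).
  by rewrite gP gP'.
have [t [ht t0 tS]] := algF_sample hg S_alg.
have := hg t ht; rewrite negb_and => /orP[tg|gt].
- have [t' [ht' t'0 t't t'S]] := algF_down ht t0 S_alg.
  have t'g := nlt_trans N t't tg.
  have t'side s : s \in S -> same_side g t' s.
    move=> sS; rewrite /same_side; case/orP: (tS s sS) => /andP[h1 h2]; rewrite h1 /=.
      by rewrite t'S.
    by rewrite (nlt_trans N t't h2) orbT.
  have shape c : c <| g -> c != 0 -> (forall s, s \in S -> same_side g c s) ->
      forall a, a \in rs -> if moving a0 a then a0 - a <| c
        else (a0 - a ~| a0 - a) && (c <| a0 - a).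
    move=> cg c0 cS a ars; rewrite nsame_refl //=.
    case: (dist a (rs_alg a ars)) => [[h1 ->]|[h1 /negPf -> _]].
      have : a0 - a \in S by rewrite mem_cat (map_f (fun a => a0 - a)) ?orbT.
      case/cS/orP => /andP[h2 h3] //.
      by have := nlt_trans N h1 h2; rewrite nle_refl.
    exact: (nlt_trans N) cg h1.
  apply: (two_places_of Q00 Q0a t'0 ht' ht t't).
  + move=> h a h0 hQ ha; have aalg : algF a by exists h.
    have [[h1 m]|[h1 _ _]] := dist a aalg.
      case: (Q0min h a h0 hQ ha) => s hs; apply: contra (hg s hs).
      by apply: (nsame_trans N); rewrite nsame_sym.
    by rewrite h1 (nlt_trans N tg h1).
  + by apply: agr => //; apply: shape.
  + by apply: agr => //; apply: shape.
have [beta [hbeta tbeta betaS]] := algF_up ht t0 S_alg.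
have [b [Q [Q1 Qb bbeta bmin]]] :
    exists b Q, [/\ Q != 0, root (lift Q) b, xi - b <| beta &
    forall (g : {poly F}) a, g != 0 -> (size g < size Q)%N ->
      root (lift g) a -> ~ xi - a <| beta].
  by apply: minimal_choice; exists a0; split=> //; apply: (nlt_trans N) tbeta.
have hb : algF b by exists Q.
(* [|s|] is the maximum of [|t|] and [|X - b|]; if the latter exceeds [|t|], it is
   larger than [|g|] and thus a value of [Fbar]. *)
have [s [hs s0 ts bs sbeta]] :
    exists s, [/\ algF s, s != 0, t <=| s, xi - b <=| s & s <| beta].
  have [bt|tb] := boolP (xi - b <=| t); first by exists t; split; rewrite ?nle_refl.
  case: (dist b hb) => [[_ m]|[_ _ e]].
    by case/negP: tb; rewrite (nsame_lel N _ m) (nltW N).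
  exists (a0 - b); split; first exact: algebraic_sub.
  - by rewrite -(nsame0 N e) xi_transc.
  - by rewrite -(nsame_ler N _ e) (nltW N).
  - by case/andP: e.
  - by rewrite -(nsame_ler N _ e).
have [c1 [hc1 sc1 c1b]] := algF_between hs hbeta s0 sbeta.
have c10 := nlt_neq0 N sc1.
have [c2 [hc2 c12 c2b]] := algF_between hc1 hbeta c10 c1b.
have sc2 := nlt_trans N sc1 c12.
have ok c : s <| c -> c <| beta -> agrees b c ps.
  move=> sc cbeta; have tc := nle_lt_trans N ts sc.
  apply: agr; first exact: (nlt_neq0 N) sc.
    move=> u uS; rewrite /same_side; case/orP: (tS u uS) => /andP[h1 h2]; rewrite h1 /=.
      by rewrite (nlt_trans N h2 tc).
    by rewrite (nlt_trans N cbeta (betaS u uS h2)) orbT.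
  move=> a ars; have xb : b - xi <| c.
    by rewrite (nlt_distC N); apply: (nle_lt_trans N) bs sc.
  have bE : b - a = (b - xi) + (xi - a) by ring.
  case: (dist a (rs_alg a ars)) => [[h1 m]|[h1 /negPf -> e]].
    rewrite m bE (nltD N) //; rewrite (nsame_ler N _ m).
    exact: (nlt_trans N) gt tc.
  have ca : c <| a0 - a.
    have aS : a0 - a \in S by rewrite mem_cat (map_f (fun a => a0 - a)) ?orbT.
    case/orP: (tS _ aS) => /andP[h2 h3].
      by have := nlt_trans N h1 h2; rewrite nle_refl.
    exact: (nlt_trans N) cbeta (betaS _ aS h3).
  have e' : b - a ~| xi - a.
    by rewrite bE (nsame_addl N) // (nsame_lel N _ e); apply: (nlt_trans N) ca.
  by rewrite (nsame_trans N e' e) (nsame_lel N _ e') (nsame_lel N _ e).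
apply: (two_places_of Q1 Qb c10 hc1 hc2 c12); [|exact: ok|exact: ok].
move=> h a h0 hQ ha; have /negP/negPn ba := bmin h a h0 hQ ha.
have e : b - a ~| xi - a.
  apply: (nsame_dist N); rewrite (_ : b - a - (xi - a) = b - xi); last by ring.
  by rewrite (nlt_distC N); apply: (nlt_le_trans N) ba.
rewrite !(nsame_lel N _ e).
by rewrite (nlt_le_trans N bbeta ba) (nlt_le_trans N c2b ba).
Qed.

Lemma two_places_all ps : two_places ps.
Proof.
have [h|h] := pselect (exists a, algF a /\ forall s, algF s -> ~~ (xi - a ~| s)).
  exact: two_places_transcendental.
apply: two_places_immediate => a ha; apply: contrapT => no; apply: h.
exists a; split=> // s hs; apply/negP => e; apply: no; by exists s.
Qed.

End Perturbation.

(** * Places are not isolated *)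

Lemma algebraic_closure_ex (K : fieldType) : countable [set: K] ->
  exists (L : closedFieldType) (phi : {rmorphism K -> L}),
    forall z : L, algebraicOver phi z.
Proof.
move=> /countable_injP[h hinj].
pose g n : option K := if pselect (exists x, h x = n) is left e
  then Some (projT1 (cid e)) else None.
have hg : pcancel h g.
  move=> x; rewrite /g; case: pselect => [e|[]]; last by exists x.
  by congr Some; case: (cid e) => z /= /hinj ->; rewrite ?in_setT.
pose KC : countFieldType := HB.pack K (PCanIsCountable hg).
have [L [phi hphi]] := countable_algebraic_closure KC.
exists L, phi => z; exact/integral_algebraic.
Qed.

Section Core.
Variables (k F K : fieldType) (j : {rmorphism k -> F}) (f : {rmorphism F -> K}).
Variable X : K.
Hypothesis trX : forall P : {poly F}, (map_poly f P).[X] = 0 -> P = 0.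
Hypothesis genX : forall z, exists P Q : {poly F},
  (map_poly f Q).[X] != 0 /\ z = (map_poly f P).[X] / (map_poly f Q).[X].
Hypothesis cK : countable [set: K].

(** The element [y] of [F] makes the value group of [Fbar] nontrivial, hence
    dense. *)
Lemma place_not_isolated (A : set K) (y : F) (zs : seq K) :
  place (f \o j) A -> y != 0 -> vmax A (f y) ->
  exists A', [/\ place (f \o j) A', A' <> A & forall z, z \in zs -> (A' z <-> A z)].
Proof.
move=> [VA trivA ratA] y0 fy.
have [L [phi algK]] := algebraic_closure_ex cK.
have [B VB BA] := valring_extend phi VA.
have N := vle_norm VB.
have le1 z : vle B (phi z) 1 <-> A z by rewrite vle1 BA.
have lt1 z : ~~ vle B 1 (phi z) <-> vmax A z.
  rewrite vlt1 /vmax /= -fmorphV BA; split=> -[/eqP|]; try by right.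
    by rewrite fmorph_eq0 => /eqP; left.
  by move/eqP ->; left; rewrite rmorph0.
pose ev : {rmorphism {poly F} -> K} := horner_eval X \o map_poly f.
have /choice[num hnum] : forall z, exists P, exists Q : {poly F}, ev Q != 0 /\ z = ev P / ev Q.
  exact: genX.
have /choice[den hden] := hnum.
have res z : vle B (phi z) 1 -> exists l, ~~ vle B 1 (phi z - (phi \o f) (j l)).
  move=> /le1/ratA[l hl]; exists l; rewrite /= -rmorphB; exact/lt1.
have triv l : vle B ((phi \o f) (j l)) 1 by apply/le1/trivA.
have y1 : ~~ vle B 1 ((phi \o f) y) by apply/lt1.
have [A1 [A2 [P1 P2 A12 agr]]] :=
  two_places_all N trX genX res triv algK y0 y1 (map num zs ++ map den zs).
have same z : z \in zs -> (A1 z <-> A z) /\ (A2 z <-> A z).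
  move=> zz; have [Q0 zE] := hden z.
  have := agr (num z) (den z); rewrite !mem_cat !map_f ?orbT //.
  case=> //; first by apply: contraNneq Q0 => ->; rewrite rmorph0.
  rewrite -[_ / _]zE => h1 h2.
  suff e : A z <-> vle B (phi (ev (num z))) (phi (ev (den z))).
    by rewrite e; split.
  rewrite -le1 {1}zE fmorph_div.
  have d0 : phi (ev (den z)) != 0 by rewrite fmorph_eq0.
  by rewrite -(nle_pmul2r N _ _ d0) divfK // mul1r.
have [e|ne] := pselect (A1 = A).
  exists A2; split=> //; first by rewrite -e => e'; apply: A12.
  by move=> z /same[].
by exists A1; split=> // z /same[].
Qed.

End Core.

(** * Valuation rings and valuations *)

Section ValueGroup.
Local Open Scope quotient_scope.
Variables (K : fieldType) (A : set K).
Hypothesis VA : valring A.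
Let N := vle_norm VA.

Definition nonzero := {x : K | x != 0}.
Definition nzM (x y : nonzero) : nonzero := Sub (val x * val y) (mulf_neq0 (valP x) (valP y)).
Lemma nzV_subproof (x : nonzero) : (val x)^-1 != 0.
Proof. by rewrite invr_eq0 (valP x). Qed.
Definition nzV (x : nonzero) : nonzero := Sub (val x)^-1 (nzV_subproof x).
Definition nz1 : nonzero := Sub 1 (oner_neq0 K).

Definition same_value (x y : nonzero) : bool := nsame (vle A) (val x) (val y).

Lemma same_value_refl : reflexive same_value.
Proof. by move=> x; apply: nsame_refl. Qed.
Lemma same_value_sym : symmetric same_value.
Proof. by move=> x y; apply: nsame_sym. Qed.
Lemma same_value_trans : transitive same_value.
Proof. by move=> y x z; apply: nsame_trans. Qed.

Canonical same_value_equiv :=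
  EquivRel same_value same_value_refl same_value_sym same_value_trans.

(** The value group is the quotient of the nonzero elements by the units of [A],
    written additively and ordered against the sizes. *)
Definition value_group := {eq_quot same_value_equiv}.
HB.instance Definition _ := Choice.on value_group.

Let cls (x : nonzero) : value_group := \pi x.
Let rep (a : value_group) : nonzero := repr a.

Let clsK a : cls (rep a) = a. Proof. exact: reprK. Qed.

Let clsE x y : (cls x = cls y) <-> nsame (vle A) (val x) (val y).
Proof. by split=> [/eqmodP|h]; last apply/eqmodP. Qed.

Let repK x : nsame (vle A) (val (rep (cls x))) (val x).
Proof. by apply/clsE; rewrite clsK. Qed.

Definition vadd (a b : value_group) : value_group := cls (nzM (rep a) (rep b)).
Definition vopp (a : value_group) : value_group := cls (nzV (rep a)).
Definition vzero : value_group := cls nz1.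
Definition vgle (a b : value_group) : bool := vle A (val (rep b)) (val (rep a)).

Let vaddE x y : vadd (cls x) (cls y) = cls (nzM x y).
Proof. by apply/clsE; apply: (nsame_mul N). Qed.

Let vgleE x y : vgle (cls x) (cls y) = vle A (val y) (val x).
Proof. by rewrite /vgle (nsame_lel N _ (repK y)) (nsame_ler N _ (repK x)). Qed.

Let vaddA : associative vadd.
Proof.
move=> a b c; rewrite -[a]clsK -[b]clsK -[c]clsK !vaddE; apply/clsE.
by rewrite /= mulrA nsame_refl.
Qed.

Let vaddC : commutative vadd.
Proof. by move=> a b; apply/clsE; rewrite /= mulrC nsame_refl. Qed.

Let vadd0 : left_id vzero vadd.
Proof.
by move=> a; rewrite -[a]clsK /vzero vaddE; apply/clsE; rewrite /= mul1r nsame_refl.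
Qed.

Let vaddN : left_inverse vzero vopp vadd.
Proof.
move=> a; rewrite -[X in vadd _ X]clsK /vopp vaddE; apply/clsE.
by rewrite /= mulVf ?nsame_refl // (valP (rep a)).
Qed.

HB.instance Definition _ := GRing.isZmodule.Build value_group vaddA vaddC vadd0 vaddN.

Let vgle_refl : reflexive vgle.
Proof. by move=> a; apply: nle_refl. Qed.
Let vgle_anti : antisymmetric vgle.
Proof.
move=> a b /andP[h1 h2]; rewrite -[a]clsK -[b]clsK; apply/clsE.
by rewrite /nsame; apply/andP.
Qed.
Let vgle_trans : transitive vgle.
Proof. by move=> b a c h1 h2; apply: (nle_trans N) h2 h1. Qed.

HB.instance Definition _ :=
  Order.Le_isPOrder.Build ring_display value_group vgle_refl vgle_anti vgle_trans.

Definition vfun_of (x : K) : option value_group :=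
  if insub x is Some u then Some (cls u) else None.

Let vfun_of0 x : vfun_of x = None <-> x = 0.
Proof.
rewrite /vfun_of; case: insubP => [u u0 ux|].
  by split=> // x0; rewrite x0 eqxx in u0.
by rewrite negbK => /eqP.
Qed.

Let vfun_ofE (x : K) (h : x != 0) : vfun_of x = Some (cls (Sub x h)).
Proof.
rewrite /vfun_of; case: insubP => [u u0 ux|]; last by rewrite h.
by congr (Some (cls _)); apply: val_inj.
Qed.

Let ole_vfun x y : ole (vfun_of x) (vfun_of y) = vle A y x.
Proof.
have [->|y0] := eqVneq y 0.
  by have /vfun_of0 -> := erefl (0 : K); rewrite (nle0x N).
have [->|x0] := eqVneq x 0.
  have /vfun_of0 -> := erefl (0 : K); rewrite vfun_ofE /=.
  by apply/esym/negbTE; rewrite (nlt0x N).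
by rewrite !vfun_ofE /= -[LHS]/(vgle _ _) vgleE.
Qed.

Let vfun_ofM x y : vfun_of (x * y) = oadd (vfun_of x) (vfun_of y).
Proof.
have /vfun_of0 v0 := erefl (0 : K).
have [->|y0] := eqVneq y 0.
  by rewrite mulr0 v0; case: (vfun_of x).
have [->|x0] := eqVneq x 0; first by rewrite mul0r v0.
rewrite !vfun_ofE ?mulf_neq0 // => h.
by rewrite /= -[_ + _]/(vadd _ _) vaddE; congr (Some (cls _)); apply: val_inj.
Qed.

Let vfun_ofD x y : ole (omin (vfun_of x) (vfun_of y)) (vfun_of (x + y)).
Proof.
rewrite /omin; case: ifP; rewrite !ole_vfun => h.
  by apply: (nleD N) => //; apply: nle_refl.
have := nle_total N y x; rewrite h /= => h'.
by apply: (nleD N) => //; apply: nle_refl.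
Qed.

Let vgle_total (a b : value_group) : (a <= b) || (b <= a).
Proof. exact: (nle_total N). Qed.

Let vgle_leD (c a b : value_group) : a <= b -> c + a <= c + b.
Proof.
rewrite -[_ <= _]/(vgle _ _) -[c + a <= _]/(vgle (vadd _ _) (vadd _ _)) => h.
rewrite vgleE /= ![val (rep c) * _]mulrC; exact: nle_mul2r.
Qed.

Definition valuation_of : valuation K :=
  Valuation vgle_total vgle_leD vfun_of0 vfun_ofM vfun_ofD.

Lemma valuation_ring_of : valuation_ring valuation_of = A.
Proof.
have v1 : Some 0 = vfun_of 1 by rewrite (vfun_ofE (oner_neq0 K)).
apply/seteqP; split=> x; rewrite /valuation_ring /= v1 ole_vfun => /vle1; apply => //.
Qed.

End ValueGroup.

Section ValuationToRing.
Variables (K : fieldType) (v : valuation K).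
Let G := vgroup v.

Let vfun0 : v 0 = None. Proof. exact/vfun_eq_infty. Qed.

Let vfun_some x : x != 0 -> exists g : G, v x = Some g.
Proof.
by move=> x0; case E: (v x) => [g|]; [exists g | move/vfun_eq_infty/eqP: E; rewrite (negPf x0)].
Qed.

Let vfun1 : v 1 = Some 0.
Proof.
have [g E] := vfun_some (oner_neq0 K); have := vfunM v 1 1.
rewrite mul1r E /= => -[/eqP]; rewrite -subr_eq subrr => /eqP <- //.
Qed.

Let vfunV x g : x != 0 -> v x = Some g -> v x^-1 = Some (- g).
Proof.
move=> x0 E; have [h Eh] := vfun_some (invr_neq0 x0).
have := vfunM v x x^-1; rewrite divff // vfun1 E Eh /= => -[/eqP].
by rewrite eq_sym addr_eq0 => /eqP ->; rewrite opprK.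
Qed.

Let vle_opp (g : G) : (0 <= - g) = (g <= 0).
Proof.
apply/idP/idP => h.
  by have := vgroup_leD g h; rewrite addr0 subrr.
by have := vgroup_leD (- g) h; rewrite addr0 addNr.
Qed.

Lemma valuation_ring_valring : valring (valuation_ring v).
Proof.
split; rewrite /valuation_ring /=.
- move=> x y hx hy; have := vfunD v x y; rewrite /omin.
  have tr (a b c : option G) : ole a b -> ole b c -> ole a c.
    by case: a b c => [a|] [b|] [c|] //=; apply: le_trans.
  by case: ifP => _; apply: tr.
- move=> x y; rewrite vfunM; case: (v x) (v y) => [a|] [b|] //= ha hb.
  apply: le_trans ha _; rewrite -[X in X <= _]addr0; exact: vgroup_leD.
- move=> x; have [->|x0] := eqVneq x 0; first by left; rewrite vfun0.
  have [g E] := vfun_some x0; rewrite (vfunV x0 E) E /= vle_opp.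
  by apply/orP; apply: vgroup_total.
Qed.

Lemma olt0_vmax x : olt (Some 0) (v x) <-> vmax (valuation_ring v) x.
Proof.
rewrite /olt /vmax /valuation_ring /=.
have [->|x0] := eqVneq x 0; first by rewrite vfun0; split=> // _; left.
have [g E] := vfun_some x0; rewrite (vfunV x0 E) E /= vle_opp; split.
  case/andP=> g0 h; right; apply/negP; apply: contra g0 => h'.
  by apply/eqP; congr Some; apply: le_anti; rewrite h h'.
case=> [/eqP|/negP h]; first by rewrite (negPf x0).
have := vgroup_total g 0; rewrite (negPf h) /= => ->; rewrite andbT.
by apply: contra h => /eqP[<-].
Qed.

Lemma trivial_on_ring (k : fieldType) (iota : {rmorphism k -> K}) :
  trivial_on iota v <-> forall a, valuation_ring v (iota a).
Proof.
rewrite /valuation_ring /=; split=> h a.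
  have [->|a0] := eqVneq a 0; first by rewrite rmorph0 vfun0.
  by rewrite h //=.
move=> a0; have ia0 : iota a != 0 by rewrite fmorph_eq0.
have [g E] := vfun_some ia0; have := h a; have := h a^-1.
rewrite fmorphV (vfunV ia0 E) E /= vle_opp => h1 h2.
by congr Some; apply: le_anti; rewrite h1 h2.
Qed.

End ValuationToRing.

Section Points.
Variables (k K : fieldType) (iota : {rmorphism k -> K}).

(** A nonzero constant is a unit, so different constants have different residue
    classes; what remains of bijectivity is surjectivity. *)
Lemma residue_fieldP (v : valuation K) : trivial_on iota v ->
  has_residue_field iota v <->
  forall x, valuation_ring v x -> exists a, vmax (valuation_ring v) (x - iota a).
Proof.
move=> tv; have VA := valuation_ring_valring v; have N := vle_norm VA.
have triv := (trivial_on_ring v iota).1 tv.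
have inE x y : residue_class v x y <-> ~~ vle (valuation_ring v) 1 (y - x).
  by rewrite /residue_class /= olt0_vmax vlt1.
have selfE x : residue_class v x x.
  by apply/inE; rewrite subrr (nlt0x N) oner_eq0.
split=> [[_ _ surj] x vx|h].
  have [a _ E] := surj (residue_class v x) (ex_intro2 _ _ x vx erefl).
  by exists a; apply/vlt1/inE; rewrite E.
split.
- by move=> a _; exists (iota a).
- move=> a b _ _ E; apply/eqP; rewrite -subr_eq0; apply/negPn/negP => ab.
  have := selfE (iota a); rewrite E => /inE/vlt1.
  rewrite -rmorphB => -[/eqP|]; first by rewrite fmorph_eq0 (negPf ab).
  by apply; rewrite -fmorphV.
- move=> _ [x vx <-]; have [a /vlt1 xa] := h x vx; exists a => //.
  apply/seteqP; split=> y /inE h1; apply/inE.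
    rewrite (_ : y - x = (y - iota a) - (x - iota a)); last by ring.
    exact: (nltB N).
  rewrite (_ : y - iota a = (y - x) + (x - iota a)); last by ring.
  exact: (nltD N).
Qed.

Lemma placeP (A : set K) : place iota A <->
  exists v, [/\ trivial_on iota v, valuation_ring v = A & has_residue_field iota v].
Proof.
split=> [[VA tA rA]|[v [tv vA rv]]].
  have E := valuation_ring_of VA; exists (valuation_of VA).
  have tv : trivial_on iota (valuation_of VA) by apply/trivial_on_ring; rewrite E.
  by split=> //; apply/(residue_fieldP tv); rewrite E.
rewrite -vA; split; first exact: valuation_ring_valring.
  by apply/trivial_on_ring.
exact/(residue_fieldP tv).
Qed.

End Points.

(** * Spaces of sets with the topology of pointwise convergence *)

(** The points of [T] are subsets of [C], and neighbourhoods prescribe the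
    membership of finitely many elements: a subspace of a power of a two-point
    space. *)
Section TraceTopology.
Variables (T : topologicalType) (C : eqType) (e : T -> set C).
Hypothesis e_inj : injective e.
Hypothesis nbhs_e : forall t (V : set T), nbhs t V <->
  exists s : seq C, forall q, (forall z, z \in s -> (e q z <-> e t z)) -> V q.

Lemma trace_clopen z : clopen [set t | e t z].
Proof.
split; last rewrite -openC; rewrite openE => t tz; apply/nbhs_e; exists [:: z] => q qz.
  by apply/qz => //; rewrite mem_head.
by move=> /= /(qz z (mem_head _ _)).
Qed.

Lemma trace_totally_disconnected : totally_disconnected [set: T].
Proof.
apply: zero_dimension_totally_disconnected => x y /eqP xy.
have [z hz] : exists z, ~ (e x z <-> e y z).
  apply: contrapT => no; apply: xy; apply: e_inj; apply/seteqP.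
  by split=> z h; apply: contrapT => h'; apply: no; exists z; tauto.
have [xz|nxz] := pselect (e x z).
  exists [set t | e t z]; split=> //; first exact: trace_clopen.
  by move=> yz; apply: hz.
exists (~` [set t | e t z]); split=> //.
  exact: (@clopenC _ _ set0 (trace_clopen z)).
move=> nyz; apply: hz; split=> // yz; exfalso; exact: nyz.
Qed.

Lemma trace_perfect :
  (forall t (s : seq C), exists q, q <> t /\ forall z, z \in s -> (e q z <-> e t z)) ->
  perfect T.
Proof.
move=> h; apply/seteqP; split=> // t [_ [V /nbhs_e[s sV] VE]].
have [q [qt qs]] := h t s; apply: qt.
have : (V `&` [set: T]) q by split=> //; apply: sV.
by rewrite VE.
Qed.

Lemma trace_compact :
  (forall F : set_system T, UltraFilter F -> exists p, e p = [set z | F [set q | e q z]]) ->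
  compact [set: T].
Proof.
move=> h; rewrite compact_ultra => F FU _; have [p pE] := h F FU.
exists p; split=> // V /nbhs_e[s]; elim: s V => [|z s IH] V sV.
  by apply: (@filterS _ F _ setT) => [q _|]; [exact: sV | exact: filterT].
have Fz : F [set q | e q z <-> e p z].
  have [pz|npz] := pselect (e p z).
    have : F [set q | e q z] by move: pz; rewrite pE.
    by apply: filterS => q qz; split.
  have [|] := in_ultra_setVsetC [set q | e q z] FU.
    by move=> Fz; case: npz; rewrite pE.
  by apply: filterS => q qz; split=> // /qz.
have /(filterI Fz) : F [set q | forall z, z \in s -> (e q z <-> e p z)].
  exact: IH.
apply: filterS => q [/= qz qs]; apply: sV => w.
by rewrite inE => /orP[/eqP -> //|]; apply: qs.
Qed.

Section Metric.
Variable R : realType.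
Hypothesis cC : countable [set: C].

(** Enumerate [C]; the distance of two sets is [1 / (m + 1)] when they first
    differ at the element of index [m]. *)
Lemma trace_metrizable : metrizable R T.
Proof.
have /countable_injP[f finj] := cC.
pose agree n t q := forall z, (f z < n)%N -> (e t z <-> e q z).
have agreeS n m t q : (n <= m)%N -> agree m t q -> agree n t q.
  by move=> nm h z zn; apply: h; apply: leq_trans nm.
have d_ex t q : exists r : R, (r = 0 \/ exists m, r = m.+1%:R^-1) /\
    forall n, (r <= n.+1%:R^-1) <-> agree n t q.
  have [all|/existsNP[n0 hn0]] := pselect (forall n, agree n t q).
    by exists 0; split=> [|n]; [left | split=> // _; rewrite invr_ge0 ler0n].
  have ex : exists n, ~~ `[< agree n t q >] by exists n0; apply/asboolP.
  case: (ex_minnP ex) => m /asboolP nm mmin.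
  case: m nm mmin => [|m] nm mmin; first by case: nm => z.
  exists m.+1%:R^-1; split=> [|n]; first by right; exists m.
  rewrite lef_pV2 ?posrE ?ltr0n // ler_nat ltnS; split=> [nm'|an].
    apply: (agreeS _ _ _ _ nm'); apply: contrapT => na.
    have /mmin : ~~ `[< agree m t q >] by apply/asboolP.
    by rewrite ltnn.
  by rewrite leqNgt; apply/negP => mn; apply: nm; apply: agreeS an.
have /choice[d2 hd] : forall tq : T * T, exists r : R,
    (r = 0 \/ exists m, r = m.+1%:R^-1) /\
    forall n, (r <= n.+1%:R^-1) <-> agree n tq.1 tq.2.
  by move=> tq; apply: d_ex.
pose d t q := d2 (t, q).
have dP t q n : (d t q <= n.+1%:R^-1) <-> agree n t q by case: (hd (t, q)).
have dV t q : d t q = 0 \/ exists m, d t q = m.+1%:R^-1 by case: (hd (t, q)).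
have dle t q t' q' : (forall n, agree n t q -> agree n t' q') -> d t' q' <= d t q.
  move=> h; case: (dV t q) => [d0|[m dm]]; last first.
    by rewrite dm; apply/dP/h/dP; rewrite dm.
  case: (dV t' q') => [-> |[m dm]]; first by rewrite d0.
  have /h/dP : agree m.+1 t q by apply/dP; rewrite d0 invr_ge0 ler0n.
  by rewrite dm lef_pV2 ?posrE ?ltr0n // ler_nat ltnn.
have deq t q : d t q = 0 <-> t = q.
  split=> [d0|->].
    have all z : e t z <-> e q z.
      have /(_ z (ltnSn _)) // : agree (f z).+1 t q.
      by apply/dP; rewrite d0 invr_ge0 ler0n.
    by apply: e_inj; apply/seteqP; split=> z /all.
  case: (dV q q) => // -[m dm].
  have : agree m.+1 q q by [].
  by move/dP; rewrite dm lef_pV2 ?posrE ?ltr0n // ler_nat ltnn.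
exists d; split=> //.
- by move=> t q; apply/eqP; rewrite eq_le; apply/andP; split; apply: dle => n h z zn;
    have := h z zn; tauto.
- move=> x y z; case: (dV x y) => [d0|[m dm]].
    by rewrite d0 add0r; move/deq: d0 => ->.
  case: (dV y z) => [d0|[l dl]].
    by rewrite d0 addr0; move/deq: d0 => ->.
  have h : d x z <= (minn m l).+1%:R^-1.
    apply/dP => w wn; have /dP h1 : d x y <= m.+1%:R^-1 by rewrite dm.
    have /dP h2 : d y z <= l.+1%:R^-1 by rewrite dl.
    move: wn; rewrite ltn_min => /andP[/h1 a /h2 b]; tauto.
  apply: (le_trans h); rewrite dm dl; case: (leqP m l) => _.
    by rewrite lerDl invr_ge0 ler0n.
  by rewrite lerDr invr_ge0 ler0n.
move=> t V; split=> [/nbhs_e[s sV]|[r r0 rV]]; last first.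
  have [n] := ltr_add_invr r0; rewrite add0r => nr.
  pose g m : seq C := if pselect (exists z, f z = m) is left h
    then [:: projT1 (cid h)] else [::].
  apply/nbhs_e; exists (flatten [seq g m | m <- iota 0 n]) => q qs; apply: rV.
  rewrite /=; apply: le_lt_trans nr; apply/dP => z zn.
  suff : z \in flatten [seq g m | m <- iota 0 n] by move/qs; tauto.
  apply/flattenP; exists (g (f z)); first by apply: map_f; rewrite mem_iota.
  rewrite /g; case: pselect => [h|[]]; last by exists z.
  by case: (cid h) => w /= /finj ->; rewrite ?in_setT ?mem_head.
have [N hN] : exists N, forall z, z \in s -> (f z < N)%N.
  elim: s {sV} => [|z s [N hN]]; first by exists 0%N.
  exists (maxn (f z).+1 N) => w.
  rewrite inE => /orP[/eqP ->|/hN h]; first by rewrite leq_max leqnn.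
  by rewrite leq_max h orbT.
exists N.+1%:R^-1; first by rewrite invr_gt0 ltr0n.
move=> q /= /ltW/dP h; apply: sV => z /hN/h; tauto.
Qed.

End Metric.
End TraceTopology.

(** * The Patch and Zariski topologies *)

(** [Blocal] and [Bfine] compare the topology generated by [B], on the subspace
    [P], with that of pointwise convergence of the sets [e]. *)
Section SubbaseTrace.
Variables (Y : topologicalType) (B : set (set Y)) (P : set Y) (C : eqType).
Variable e : set_type P -> set C.
Hypothesis Bopen : forall W : set Y, open W <->
  exists2 D, D `<=` finI_from B id & \bigcup_(A in D) A = W.
Hypothesis Blocal : forall b (t : set_type P), B b -> b (set_val t) ->
  exists s : seq C, forall q : set_type P,
    (forall z, z \in s -> (e q z <-> e t z)) -> b (set_val q).
Hypothesis Bfine : forall t z, exists bs : seq (set Y),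
  (forall b, b \in bs -> B b /\ b (set_val t)) /\
  forall q : set_type P, (forall b, b \in bs -> b (set_val q)) -> (e q z <-> e t z).

Lemma subbase_trace_nbhs t (V : set (set_type P)) : nbhs t V <->
  exists s : seq C, forall q, (forall z, z \in s -> (e q z <-> e t z)) -> V q.
Proof.
split.
  rewrite nbhsE => -[U [[W /Bopen[D sD WE] <-] /= Wt] UV].
  move: Wt; rewrite /preimage /= -WE => -[b Db bt].
  have [Dj sDj bE] := sD b Db.
  have [s hs] : exists s : seq C, forall q : set_type P,
      (forall z, z \in s -> (e q z <-> e t z)) ->
      forall c, c \in enum_fset Dj -> c (set_val q).
    have : {subset enum_fset Dj <= Dj} by [].
    elim: (enum_fset Dj) => [_|c r IH hr]; first by exists [::].
    have cD : c \in Dj by apply: hr; rewrite mem_head.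
    have ct : c (set_val t) by move: bt; rewrite -bE; apply.
    have [s1 h1] := Blocal (set_mem (sDj c cD)) ct.
    have [|s2 h2] := IH; first by move=> c' c'r; apply: hr; rewrite inE c'r orbT.
    exists (s1 ++ s2) => q hq c'; rewrite inE => /orP[/eqP ->|].
      by apply: h1 => z zs; apply: hq; rewrite mem_cat zs.
    by apply: h2 => z zs; apply: hq; rewrite mem_cat zs orbT.
  exists s => q /hs hq; apply: UV; rewrite /preimage /= -WE; exists b => //.
  by rewrite -bE => c; apply: hq.
move=> [s]; elim: s V => [|z s IH] V sV.
  by apply: (@filterS _ _ _ setT) => [q _|]; [exact: sV | exact: filterT].
have op b : B b -> b (set_val t) -> nbhs t [set q : set_type P | b (set_val q)].
  move=> hb bt; rewrite nbhsE; exists [set q : set_type P | b (set_val q)] => //.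
  split=> //; exists b => //; apply/Bopen; exists [set b]; last by rewrite bigcup_set1.
  move=> _ ->; exists (fset1 b); last by rewrite set_fset1 bigcap_set1.
  by move=> c; rewrite in_fset1 => /eqP ->; apply: mem_set.
have tz : nbhs t [set q | e q z <-> e t z].
  have [bs [hbs hz]] := Bfine t z.
  apply: (@filterS _ _ _ [set q | forall b, b \in bs -> b (set_val q)]) => //.
  elim: bs hbs {hz} => [_|b bs IHb hbs].
    by apply: (@filterS _ _ _ setT) => [q _ //|]; exact: filterT.
  have [Bb bt] := hbs b (mem_head _ _).
  have /(filterI (op b Bb bt)) : nbhs t [set q | forall b', b' \in bs -> b' (set_val q)].
    by apply: IHb => b' b'bs; apply: hbs; rewrite inE b'bs orbT.
  apply: filterS => q [bq hq] b'; rewrite inE => /orP[/eqP -> //|]; exact: hq.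
have /(filterI tz) : nbhs t [set q | forall z, z \in s -> (e q z <-> e t z)].
  exact: IH.
apply: filterS => q [/= qz qs]; apply: sV => w.
by rewrite inE => /orP[/eqP -> //|]; apply: qs.
Qed.

End SubbaseTrace.

Section ZRPoints.
Variables (k K : fieldType) (iota : {rmorphism k -> K}).

Lemma ZR_OE x (p : ZR iota) : ZR_O x p <-> sval p x.
Proof.
split=> [[v [_ <- //]]|px]; case: (svalP p) => v tv vE; exists v; split=> //.
by move: px; rewrite -vE.
Qed.

Lemma ZR_UE x (p : ZR iota) : ZR_U x p <-> vmax (sval p) x.
Proof.
split=> [[v [_ <- /olt0_vmax //]]|px]; case: (svalP p) => v tv vE; exists v; split=> //.
by apply/olt0_vmax; rewrite vE.
Qed.

Definition patch_ring (t : ZRk_patch iota) : set K := sval (sval t).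
Definition zariski_ring (t : ZRk_zariski iota) : set K := sval (sval t).

Lemma patch_ring_inj : injective patch_ring.
Proof.
by move=> [[a pa] ha] [[b pb] hb] /= h; apply/val_inj/eq_sig_hprop.
Qed.

Lemma zariski_ring_inj : injective zariski_ring.
Proof.
by move=> [[a pa] ha] [[b pb] hb] /= h; apply/val_inj/eq_sig_hprop.
Qed.

Lemma patch_ring_place t : place iota (patch_ring t).
Proof. by apply/placeP; have := set_mem (svalP t). Qed.

Lemma zariski_ring_place t : place iota (zariski_ring t).
Proof. by apply/placeP; have := set_mem (svalP t). Qed.

Lemma place_point A : place iota A ->
  exists p : ZR iota, sval p = A /\ ZR_classes (has_residue_field iota) p.
Proof.
move=> /placeP[v [tv vA rv]].
have ex : exists2 v : valuation K, trivial_on iota v & valuation_ring v = A by exists v.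
by exists (exist _ A ex); split=> //; exists v.
Qed.

Lemma patch_ring_surj A : place iota A -> exists t, patch_ring t = A.
Proof. by move=> /place_point[p [<- hp]]; exists (exist _ p (mem_set hp)). Qed.

Lemma zariski_ring_surj A : place iota A -> exists t, zariski_ring t = A.
Proof. by move=> /place_point[p [<- hp]]; exists (exist _ p (mem_set hp)). Qed.

Lemma place_compl A z : place iota A -> ~ A z <-> z != 0 /\ vmax A z^-1.
Proof.
move=> [VA _ _]; rewrite /vmax /= invrK; split=> [nz|[z0 [/eqP|//]]].
  by split; [apply: contra_notN nz => /eqP ->; apply: vr0 | right].
by rewrite invr_eq0 (negPf z0).
Qed.

(** For [z != 0] the complement of the set of rings that contain [z] is the set
    of those in which [z^-1] has positive value. *)
Lemma patch_nbhs t (V : set (ZRk_patch iota)) : nbhs t V <->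
  exists s : seq K, forall q,
    (forall z, z \in s -> (patch_ring q z <-> patch_ring t z)) -> V q.
Proof.
apply: (@subbase_trace_nbhs (ZR_patch iota)
  (range (@ZR_O _ _ iota) `|` range (@ZR_U _ _ iota))
  (ZR_classes (has_residue_field iota)) K patch_ring _ _ _ t V).
- by move=> W; split.
- move=> b u [[x _ <-]|[x _ <-]] bu.
    exists [:: x] => q /(_ x (mem_head _ _)) h.
    by apply/ZR_OE/h/ZR_OE.
  exists [:: x^-1] => q /(_ x^-1 (mem_head _ _)) h; apply/ZR_UE.
  by case/ZR_UE: bu => [->|nx]; [left | right=> /h].
move=> u z; have [uz|nuz] := pselect (patch_ring u z).
  exists [:: ZR_O z]; split=> [b|q /(_ _ (mem_head _ _))/ZR_OE qz]; last by split.
  by rewrite inE => /eqP ->; split; [left; exists z | apply/ZR_OE].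
have [z0 uz'] := (place_compl z (patch_ring_place u)).1 nuz.
exists [:: ZR_U z^-1]; split=> [b|q /(_ _ (mem_head _ _))/ZR_UE qz].
  by rewrite inE => /eqP ->; split; [right; exists z^-1 | apply/ZR_UE].
split=> // h; exfalso.
by apply: (place_compl z (patch_ring_place q)).2 h.
Qed.

(** Let [w = z^-1], with [z] outside the ring.  The residue of [w] is zero, hence
    [1 / (w - a)] is integral for all nonzero constants [a].  Conversely, an
    integral [w] for which all these are integral has no nonzero residue.  For
    finite [k] these are finitely many open conditions. *)
Lemma zariski_nbhs t (V : set (ZRk_zariski iota)) : finite_set [set: k] -> nbhs t V <->
  exists s : seq K, forall q,
    (forall z, z \in s -> (zariski_ring q z <-> zariski_ring t z)) -> V q.
Proof.
move=> /finite_seqP[ks ksE].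
have ksP a : a \in ks by have : [set: k] a by []; rewrite ksE.
apply: (@subbase_trace_nbhs (ZR_zariski iota) (range (@ZR_O _ _ iota))
  (ZR_classes (has_residue_field iota)) K zariski_ring _ _ _ t V).
- by move=> W; split.
- move=> b u [x _ <-] bu; exists [:: x] => q /(_ x (mem_head _ _)) h.
  by apply/ZR_OE/h/ZR_OE.
move=> u z; have pu := zariski_ring_place u.
have [uz|nuz] := pselect (zariski_ring u z).
  exists [:: ZR_O z]; split=> [b|q /(_ _ (mem_head _ _))/ZR_OE qz]; last by split.
  by rewrite inE => /eqP ->; split; [exists z | apply/ZR_OE].
have [z0 uz'] := (place_compl z pu).1 nuz.
have wa a : a != 0 -> z^-1 - iota a != 0.
  move=> a0; apply: contra_notN nuz; rewrite subr_eq0 => /eqP wE.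
  by rewrite -[z]invrK wE -fmorphV; apply: (pl_triv pu).
pose O x : set (ZR_zariski iota) := ZR_O x.
exists (O z^-1 :: [seq O (z^-1 - iota a)^-1 | a <- ks & a != 0]); split=> [b|q hq].
  rewrite inE => /orP[/eqP ->|/mapP[a]].
    split; [by exists z^-1 | apply/ZR_OE].
    case: (vr_total (pl_valring pu) z^-1) => //; rewrite invrK => h.
    by case: nuz.
  rewrite mem_filter => /andP[a0 _] ->; split; first by exists (z^-1 - iota a)^-1.
  apply/ZR_OE; apply: contrapT => n; have N := vle_norm (pl_valring pu).
  have h1 : ~~ vle (zariski_ring u) 1 (z^-1 - iota a) by apply/vlt1; right.
  have h2 : ~~ vle (zariski_ring u) 1 z^-1 by apply/vlt1.
  have /vlt1[/eqP|] : ~~ vle (zariski_ring u) 1 (iota a).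
    by have := nltB N h2 h1; rewrite opprB addrC subrK.
    by rewrite fmorph_eq0 (negPf a0).
  by rewrite -fmorphV; apply; apply: (pl_triv pu).
split=> // qz; exfalso.
have pq := zariski_ring_place q.
have /ZR_OE/(pl_rat pq)[a ha] := hq _ (mem_head _ _).
have [a0|a0] := eqVneq a 0.
  move: ha; rewrite a0 rmorph0 subr0 => h.
  by apply: (place_compl z pq).2 qz.
case: ha => [/eqP|]; first by rewrite (negPf (wa a a0)).
apply; apply/ZR_OE; apply: hq; rewrite inE; apply/orP; right; apply/mapP.
by exists a => //; rewrite mem_filter a0 ksP.
Qed.

End ZRPoints.

(** * Rational function fields *)

(** The intermediate field [k(x_1, ..., x_{n-1})] is needed as a type; it is built
    as a subtype of [K]. *)
Section FractionSubfield.
Variables (D : idomainType) (K : fieldType) (ev : {rmorphism D -> K}).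

Definition frac_pred : {pred K} :=
  fun z => `[< exists P Q, ev Q != 0 /\ z = ev P / ev Q >].

Lemma frac_predP z : reflect (exists P Q, ev Q != 0 /\ z = ev P / ev Q) (z \in frac_pred).
Proof. exact: asboolP. Qed.

Lemma frac_divring_closed : divring_closed frac_pred.
Proof.
split.
- by apply/frac_predP; exists 1, 1; rewrite rmorph1 oner_eq0 divr1.
- move=> _ _ /frac_predP[P [Q [Q0 ->]]] /frac_predP[P' [Q' [Q'0 ->]]].
  apply/frac_predP; exists (P * Q' - P' * Q), (Q * Q').
  rewrite rmorphB !rmorphM mulf_neq0 //; split=> //.
  by field; rewrite Q0 Q'0.
- move=> _ _ /frac_predP[P [Q [Q0 ->]]] /frac_predP[P' [Q' [Q'0 ->]]].
  apply/frac_predP; have [P'0|P'0] := eqVneq (ev P') 0.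
    by exists 0, 1; rewrite rmorph0 rmorph1 oner_eq0 P'0 mul0r invr0 mulr0 mul0r.
  by exists (P * Q'), (Q * P'); rewrite invf_div mulf_div !rmorphM mulf_neq0.
Qed.

HB.instance Definition _ := GRing.isDivringClosed.Build K frac_pred frac_divring_closed.

Record frac_field := FracField { fval :> K; fvalP : fval \in frac_pred }.
HB.instance Definition _ := [isSub for fval].
HB.instance Definition _ := [Choice of frac_field by <:].
HB.instance Definition _ := [SubChoice_isSubIntegralDomain of frac_field by <:].
HB.instance Definition _ := [SubIntegralDomain_isSubField of frac_field by <:].

Definition frac_val (z : frac_field) : K := fval z.
Lemma frac_val_is_zmod_morphism : zmod_morphism frac_val.
Proof. by []. Qed.
Lemma frac_val_is_monoid_morphism : monoid_morphism frac_val.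
Proof. by []. Qed.
HB.instance Definition _ :=
  GRing.isZmodMorphism.Build _ _ frac_val frac_val_is_zmod_morphism.
HB.instance Definition _ :=
  GRing.isMonoidMorphism.Build _ _ frac_val frac_val_is_monoid_morphism.

Lemma of_D_subproof d : ev d \in frac_pred.
Proof. by apply/frac_predP; exists d, 1; rewrite rmorph1 oner_eq0 divr1. Qed.

Definition of_D d : frac_field := FracField (of_D_subproof d).

Lemma of_D_is_zmod_morphism : zmod_morphism of_D.
Proof. by move=> a b; apply: val_inj; rewrite /= rmorphB. Qed.
Lemma of_D_is_monoid_morphism : monoid_morphism of_D.
Proof.
by split=> [|a b]; apply: val_inj; rewrite /= ?rmorph1 ?rmorphM.
Qed.
HB.instance Definition _ := GRing.isZmodMorphism.Build _ _ of_D of_D_is_zmod_morphism.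
HB.instance Definition _ := GRing.isMonoidMorphism.Build _ _ of_D of_D_is_monoid_morphism.

Lemma clear_denominators (P : {poly frac_field}) : exists q (Q : {poly D}),
  ev q != 0 /\ ev q *: map_poly frac_val P = map_poly ev Q.
Proof.
elim/poly_ind: P => [|P c [q [Q [q0 E]]]].
  by exists 1, 0; rewrite !rmorph1 oner_eq0 !rmorph0 scaler0.
have /frac_predP[a [b [b0 cE]]] := fvalP c.
exists (q * b), (b *: Q * 'X + (q * a)%:P); rewrite rmorphM mulf_neq0 //; split=> //.
rewrite !rmorphD !rmorphM /= !map_polyX !map_polyC map_polyZ /= -E scalerDr.
congr (_ + _).
  by rewrite scalerA scalerAl [ev b * _]mulrC.
rewrite -[LHS]mul_polyC -!polyCM /frac_val cE; congr polyC.
by rewrite mulrACA divff // mulr1.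
Qed.

End FractionSubfield.

Section RationalFunctionField.
Variables (k K : fieldType) (iota : {rmorphism k -> K}) (n : nat) (x : 'I_n -> K).
Hypothesis hx : algebraically_independent iota x.
Hypothesis hK : generates_field iota x.

Lemma rational_countable : countable [set: k] -> countable [set: K].
Proof.
move=> /countable_injP[h hinj].
pose g c : k := if pselect (exists a, h a = c) is left e then projT1 (cid e) else 0.
have hg a : g (h a) = a.
  rewrite /g; case: pselect => [e|[]]; last by exists a.
  by case: (cid e) => b /= /hinj ->; rewrite ?in_setT.
pose ev (l : seq (multinom n * nat)) : K := \sum_(mc <- l) iota (g mc.2) * mmap1 x mc.1.
have evE p : exists l, mmap iota x p = ev l.
  exists [seq (m, h (mcoeff m p)) | m <- msupp p].
  by rewrite /ev big_map; apply: eq_bigr => m _; rewrite hg.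
pose frac l := ev l.1 / ev l.2.
have cov : [set: K] `<=` range frac.
  move=> z _; have [p [q [_ ->]]] := hK z.
  by have [a ->] := evE p; have [b ->] := evE q; exists (a, b).
apply: sub_countable (subset_card_le cov) _.
exact: sub_countable (card_image_le _ _) (countableP _).
Qed.

(** The valuation by leading monomials.  It has residue field [k] because two
    polynomials with the same leading monomial differ, after scaling one of them
    by a constant, by a polynomial with a smaller one. *)
Definition lead_le : rel (mpoly n k) := fun p q =>
  (p == 0) || (q != 0) && (mlead p <= mlead q)%O.

Lemma mlead_mul (p q : mpoly n k) : p != 0 -> q != 0 ->
  mlead (p * q) = mnm_add (mlead p) (mlead q).
Proof. by move=> p0 q0; rewrite mleadM_proper // mulf_neq0 // mleadc_eq0. Qed.

Lemma lead_le_norm : norm_rel lead_le.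
Proof.
split; rewrite /lead_le.
- move=> p q; have [->|p0] := eqVneq p 0; first by [].
  by have [->|q0] //= := eqVneq q 0; apply: le_total.
- move=> q p r; have [->|p0] //= := eqVneq p 0.
  have [->|q0] //= := eqVneq q 0; have [->|r0] //= := eqVneq r 0.
  exact: le_trans.
- move=> r p q r0; rewrite !mulf_eq0 !negb_or (negPf r0) orbF andbT.
  have [->|p0] //= := eqVneq p 0; have [->|q0] //= := eqVneq q 0.
  by rewrite !mlead_mul // lemc_add2l.
- move=> p q r; have [->|p0] //= := eqVneq p 0; first by rewrite add0r.
  have [->|q0] //= := eqVneq q 0; first by rewrite addr0 (negPf p0).
  have [->|r0] //= := eqVneq r 0; move=> h1 h2; apply/orP; right.
  by apply: le_trans (mleadD_le _ _) _; rewrite leUx h1.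
- by move=> p; rewrite eqxx orbF => /eqP.
Qed.

Lemma place_ex : exists A, place iota A.
Proof.
exists (frac_ring (mmap iota x) lead_le).
apply: (frac_place hx hK lead_le_norm (iD := @mpolyC n k)).
- by move=> l; exact: mmapC.
- move=> l; rewrite /lead_le oner_eq0 mleadC mlead1 lexx; exact: orbT.
move=> p q q0; have [->|p0] := eqVneq p 0.
  by exists 0; rewrite mpolyC0 mul0r subr0 /lead_le (negPf q0) eqxx.
rewrite /lead_le (negPf p0) q0 /= le_eqVlt => /orP[/eqP pq|pq]; last first.
  by exists 0; rewrite mpolyC0 mul0r subr0 (negPf q0) p0 /= -ltNge.
exists (mcoeff (mlead p) p / mcoeff (mlead q) q); set r := _ - _.
rewrite (negPf q0) /=; have [//|r0 /=] := eqVneq r 0.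
rewrite -ltNge lt_neqAle; apply/andP; split; last first.
  apply: le_trans (mleadB_le _ _) _; rewrite leUx pq lexx /=.
  by rewrite mul_mpolyC mleadZ_le.
apply: contra_neq r0 => rq; apply/eqP; rewrite -mleadc_eq0 rq mcoeffB mcoeffCM.
by rewrite divfK ?mleadc_eq0 // -{1}pq subrr.
Qed.

End RationalFunctionField.

Lemma place_ext (k K : fieldType) (i i' : k -> K) (A : set K) :
  i =1 i' -> place i A -> place i' A.
Proof.
move=> ii' [VA tA rA]; split=> // [l|z /rA[l]]; first by rewrite -ii'.
by rewrite ii'; exists l.
Qed.

(** [k(x_0, ..., x_n)] as a simple extension of the field [k(x_0, ..., x_{n-1})]. *)
Section Tower.
Variables (k K : fieldType) (iota : {rmorphism k -> K}) (n : nat) (x : 'I_n.+1 -> K).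
Hypothesis hx : algebraically_independent iota x.
Hypothesis hK : generates_field iota x.

Let widen (i : 'I_n) : 'I_n.+1 := widen_ord (leqnSn n) i.
Let X := x ord_max.
Let D : idomainType := mpoly n k.
Let ev : {rmorphism D -> K} := mmap iota (x \o widen).

Lemma mwiden_sum (p : mpoly n k) :
  mwiden p = \sum_(m <- msupp p) mcoeff m p *: mpolyX k (mnmwiden m).
Proof.
rewrite [in LHS](mpolyE p) (raddf_sum (@mwiden n k)); apply: eq_bigr => m _.
by rewrite /= mwidenZ mwidenX.
Qed.

Lemma mmap_mwiden (p : mpoly n k) : mmap iota x (mwiden p) = ev p.
Proof.
rewrite mwiden_sum raddf_sum; apply: eq_bigr => m _ /=.
rewrite mmapZ mmapX /mmap1 big_ord_recr /= mnmwiden_ordmax expr0 mulr1.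
by congr (_ * _); apply: eq_bigr => i _; rewrite mnmwiden_widen.
Qed.

Lemma ev_inj p : ev p = 0 -> p = 0.
Proof. by rewrite -mmap_mwiden => /hx; rewrite -(mwiden0 n) => /inj_mwiden. Qed.

Lemma mmap_muni (p : mpoly n.+1 k) : mmap iota x p = (map_poly ev (muni p)).[X].
Proof.
rewrite muniE [LHS]/mmap rmorph_sum horner_sum; apply: eq_bigr => m _.
rewrite /= map_polyZ map_polyXn hornerZ hornerXn /ev /=.
rewrite mmapZ mmapX /mmap1 big_ord_recr /= -mulrA; congr (_ * (_ * _)).
by apply: eq_bigr => i _; rewrite mnmE.
Qed.

Lemma muni_mwiden (p : mpoly n k) : muni (mwiden p) = p%:P.
Proof.
rewrite mwiden_sum (raddf_sum (@muni n k)) [in RHS](mpolyE p) (raddf_sum polyC).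
apply: eq_bigr => m _ /=.
rewrite muniZ muniE msuppX big_seq1 mcoeffX eqxx scale1r.
rewrite mnmwiden_ordmax expr0 alg_polyC -[LHS]mul_polyC -polyCM mul_mpolyC.
congr (_ *: mpolyX _ _)%:P.
by apply/mnmP => i; rewrite mnmE mnmwiden_widen.
Qed.

Lemma mmulti_horner (Q : {poly mpoly n k}) :
  mmap iota x (mmulti Q) = (map_poly ev Q).[X].
Proof.
rewrite /mmulti raddf_sum /= (@horner_coef_wide _ (size Q)) ?size_poly //.
apply: eq_bigr => i _.
by rewrite rmorphM rmorphXn /= mmap_mwiden mmapX mmap1U coef_map.
Qed.

Lemma muni_mmulti (Q : {poly mpoly n k}) : muni (mmulti Q) = Q.
Proof.
rewrite -[RHS]coefK poly_def /mmulti raddf_sum; apply: eq_bigr => i _ /=.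
rewrite rmorphM rmorphXn /= muni_mwiden mul_polyC; congr (_ *: _ ^+ _).
rewrite muniE msuppX big_seq1 mcoeffX eqxx scale1r mnm1E eqxx expr1.
set m0 := Multinom _; rewrite (_ : m0 = mnm0) ?mpolyX0 ?scale1r //.
apply/mnmP => l; rewrite mnmE mnm0E mnm1E.
by rewrite -val_eqE /= gtn_eqF.
Qed.

Lemma poly_transc (Q : {poly mpoly n k}) : (map_poly ev Q).[X] = 0 -> Q = 0.
Proof.
rewrite -mmulti_horner => /hx h; have := muni_mmulti Q; by rewrite h muni0.
Qed.

(** Either [x_0] minus its residue or [x_0^-1] has positive value, and both are
    in the subfield over which the last variable is transcendental. *)
Lemma rational_place_not_isolated (A : set K) (zs : seq K) : (0 < n)%N ->
  countable [set: K] -> place iota A ->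
  exists A', [/\ place iota A', A' <> A & forall z, z \in zs -> (A' z <-> A z)].
Proof.
move=> n0 cK pA.
pose j : {rmorphism k -> frac_field ev} := of_D ev \o @mpolyC n k.
have jE l : frac_val (j l) = iota l by rewrite /frac_val /= mmapC.
have trX (P : {poly frac_field ev}) : (map_poly (@frac_val _ _ ev) P).[X] = 0 -> P = 0.
  move=> PX; have [q [Q [q0 E]]] := clear_denominators P.
  have Q0 : Q = 0 by apply: poly_transc; rewrite -E hornerZ PX mulr0.
  move: E; rewrite Q0 rmorph0 => /eqP; rewrite scaler_eq0 (negPf q0) /=.
  by rewrite map_poly_eq0 => /eqP.
have mapE (p : mpoly n.+1 k) :
    (map_poly (@frac_val _ _ ev) (map_poly (of_D ev) (muni p))).[X] = mmap iota x p.
  by rewrite -map_poly_comp mmap_muni.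
have genX z : exists P Q : {poly frac_field ev},
    (map_poly (@frac_val _ _ ev) Q).[X] != 0 /\
    z = (map_poly (@frac_val _ _ ev) P).[X] / (map_poly (@frac_val _ _ ev) Q).[X].
  have [p [q [q0 ->]]] := hK z.
  exists (map_poly (of_D ev) (muni p)), (map_poly (of_D ev) (muni q)).
  split; first by rewrite (mapE q).
  exact: (congr2 (fun a b => a / b) (esym (mapE p)) (esym (mapE q))).
pose i0 := Ordinal n0; pose x0 := of_D ev (mpolyX k (mnm1 i0)).
have x0E a : x0 - j a != 0.
  rewrite -[x0 - _](rmorphB (of_D ev)); apply/eqP => /(congr1 val) /=.
  move=> /ev_inj /(congr1 (mcoeff (mnm1 i0))) /eqP.
  rewrite mcoeffB mcoeffX eqxx mcoeffC mcoeff0 (_ : (mnm1 i0 == mnm0) = false).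
    by rewrite mulr0 subr0 oner_eq0.
  by apply/eqP => /(congr1 (fun m : multinom n => m i0)); rewrite mnm1E eqxx mnm0E.
have [y [y0 yA]] : exists y : frac_field ev, y != 0 /\ vmax A (frac_val y).
  have [Ax0|nAx0] := pselect (A (frac_val x0)).
    have [a ha] := pl_rat pA Ax0; exists (x0 - j a); split=> //.
    by move: ha; rewrite -jE -(rmorphB (@frac_val _ _ ev)).
  exists x0^-1; split; last by right; rewrite fmorphV invrK.
  by rewrite invr_eq0; have := x0E 0; rewrite rmorph0 subr0.
have pA' : place (@frac_val _ _ ev \o j) A by apply: place_ext pA => l; rewrite -jE.
have [A' [pA'' A'A agr]] := place_not_isolated trX genX cK zs pA' y0 yA.
by exists A'; split=> //; apply: place_ext pA'' => l; exact: jE.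
Qed.

End Tower.

(** * Limits of places and the theorem *)

(** The limit of an ultrafilter of sets consists of the elements that belong to
    almost all of them.  The ring axioms pass to the limit; so does the existence
    of a residue, as one of finitely many constants works almost everywhere. *)
Lemma ultra_place (T : Type) (k K : fieldType) (i : {rmorphism k -> K}) (e : T -> set K)
    (F : set_system T) : finite_set [set: k] -> (forall t, place i (e t)) ->
  UltraFilter F -> place i [set z | F [set q | e q z]].
Proof.
move=> /finite_seqP[ks ksE] pl FU.
have ksP a : a \in ks by have : [set: k] a by []; rewrite ksE.
split=> [|a|z /= Fz].
- split=> /= [x y Fx Fy|x y Fx Fy|x].
  + apply: filterS (filterI Fx Fy) => q [qx qy].
    exact: (vr_add (pl_valring (pl q))).
  + apply: filterS (filterI Fx Fy) => q [qx qy].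
    exact: (vr_mul (pl_valring (pl q))).
  + have [|h] := in_ultra_setVsetC [set q | e q x] FU; first by left.
    right; apply: filterS h => q nqx.
    by case: (vr_total (pl_valring (pl q)) x).
- by apply: (@filterS _ _ _ setT) => [q _|]; [exact: (pl_triv (pl q)) | exact: filterT].
apply: contrapT => no.
have bad a : z - i a != 0 /\ F [set q | e q (z - i a)^-1].
  split; first by apply/eqP => h; apply: no; exists a; left.
  by apply: contrapT => h; apply: no; exists a; right.
have : F [set q | forall a, a \in ks -> e q (z - i a)^-1].
  elim: ks {ksE ksP} => [|a ks IH].
    by apply: (@filterS _ _ _ setT) => [q _ //|]; exact: filterT.
  have [_ Fa] := bad a; apply: filterS (filterI Fa IH) => q [qa qs] b.
  by rewrite inE => /orP[/eqP -> //|]; exact: qs.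
move=> /(filterI Fz)/filter_ex[q [qz qs]].
have [a [/eqP|]] := pl_rat (pl q) qz; last by apply; exact: qs.
by have [h _] := bad a; rewrite (negPf h).
Qed.

Theorem theorem4p45 (R : realType) (n : nat) (k K : fieldType)
    (iota : {rmorphism k -> K}) (x : 'I_n -> K)
    (hn : (2 <= n)%N)
    (hk : countable [set: k])
    (hx : algebraically_independent iota x)
    (hK : generates_field iota x) :
  [/\ totally_disconnected [set: ZRk_patch iota],
      perfect (ZRk_patch iota)
    & metrizable R (ZRk_patch iota)] /\
  (finite_set [set: k] ->
     is_cantor_set R (ZRk_patch iota) /\ is_cantor_set R (ZRk_zariski iota)).
Proof.
have cK := rational_countable hK hk.
have isol (A : set K) (s : seq K) : place iota A ->
    exists A', [/\ place iota A', A' <> A & forall z, z \in s -> (A' z <-> A z)].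
  case: n hn x hx hK => // m hm x' hx' hK'.
  exact: (rational_place_not_isolated hx' hK').
have [A0 pA0] := place_ex hx hK.
have patch_inj := @patch_ring_inj k K iota.
have zar_inj := @zariski_ring_inj k K iota.
have patch_perfect : perfect (ZRk_patch iota).
  apply: (trace_perfect (@patch_nbhs k K iota)) => t s.
  have [A' [pA' A't agr]] := isol _ s (patch_ring_place t).
  have [q qE] := patch_ring_surj pA'; exists q; rewrite qE; split=> // qt.
  by apply: A't; rewrite -qE qt.
split.
  split=> //; first exact: trace_totally_disconnected patch_inj (@patch_nbhs k K iota).
  exact: trace_metrizable patch_inj (@patch_nbhs k K iota) R cK.
move=> fk.
have zn t V := @zariski_nbhs k K iota t V fk.
split; split.
- by have [t _] := patch_ring_surj pA0; exists t.
- apply: (trace_compact (@patch_nbhs k K iota)) => F FU.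
  by apply: patch_ring_surj; apply: ultra_place => //; apply: patch_ring_place.
- exact: trace_metrizable patch_inj (@patch_nbhs k K iota) R cK.
- exact: trace_totally_disconnected patch_inj (@patch_nbhs k K iota).
- exact: patch_perfect.
- by have [t _] := zariski_ring_surj pA0; exists t.
- apply: (trace_compact zn) => F FU.
  by apply: zariski_ring_surj; apply: ultra_place => //; apply: zariski_ring_place.
- exact: trace_metrizable zar_inj zn R cK.
- exact: trace_totally_disconnected zar_inj zn.
- apply: (trace_perfect zn) => t s.
  have [A' [pA' A't agr]] := isol _ s (zariski_ring_place t).
  have [q qE] := zariski_ring_surj pA'; exists q; rewrite qE; split=> // qt.
  by apply: A't; rewrite -qE qt.
Qed.
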